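(* Let $\Omega\subset\mathbb{R}^n$ be a bounded domain with smooth boundary, $0<\alpha<1$, $f^1,f^2\in C^\alpha(\Omega)$, $\psi^1,\psi^2\in C^{2,\alpha}(\Omega)$ with $\psi^1+\psi^2\ge0$ in $\Omega$, and $g^1,g^2\in C^2$ with $g^1-g^2+\psi^1\ge0$ and $g^2-g^1+\psi^2\ge0$ on $\partial\Omega$. Let $(u^1_0,u^2_0)$ be the solution of the system $$\begin{cases}\min(-\Delta u^1+f^1,\;u^1-u^2+\psi^1)=0,\\ \min(-\Delta u^2+f^2,\;u^2-u^1+\psi^2)=0,\\ \min(-\Delta u^1+f^1,\;-\Delta u^2+f^2)=0\end{cases}\quad\text{in }\Omega,\qquad u^i=g^i\ \text{on }\partial\Omega.$$ Then $(u^1_0,u^2_0)$ is the minimal solution of the system $$\begin{cases}\min(-\Delta u^1+f^1,\;u^1-u^2+\psi^1)=0,\\ \min(-\Delta u^2+f^2,\;u^2-u^1+\psi^2)=0\end{cases}\quad\text{in }\Omega,\qquad u^i=g^i\ \text{on }\partial\Omega;$$ that is, if $(v^1,v^2)$ solves the latter two-equation system with the same boundary data, then $u^1_0\le v^1$ and $u^2_0\le v^2$ in $\Omega$.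
   Context: Solutions are strong solutions: pairs with $u^i\in W^{2,p}(\Omega)$ for every $p<\infty$ such that $u^1-u^2+\psi^1\ge0$ and $u^2-u^1+\psi^2\ge0$ in $\Omega$; if the first (respectively second) inequality is strict at some point, then $\Delta u^1=f^1$ (respectively $\Delta u^2=f^2$) in a neighborhood of that point; and $-\Delta u^i+f^i\ge0$ a.e. For the three-equation system one requires in addition $\min(-\Delta u^1+f^1,-\Delta u^2+f^2)=0$ a.e. in $\Omega$; the three-equation system has a unique solution. $C^{\alpha}(\Omega)$ and $C^{2,\alpha}(\Omega)$ are the usual Hölder spaces with derivatives continuous up to $\overline\Omega$ and finite Hölder seminorm on $\overline\Omega$. *)

(* Defs.v *)
From HB Require Import structures.
From mathcomp Require Import all_boot all_order all_algebra.
From mathcomp Require Import all_classical all_reals all_analysis.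

Set Implicit Arguments.
Unset Strict Implicit.
Unset Printing Implicit Defensive.
Import Order.TTheory GRing.Theory Num.Theory.
Import numFieldNormedType.Exports.
Local Open Scope classical_set_scope.
Local Open Scope ring_scope.

(* The norm of the library on 'rV[R]_n is the sup norm, equivalent to the
   Euclidean one: boundedness, the topology and finiteness of Hoelder seminorms
   are unaffected. *)

(* The sigma-algebra generated by the coordinates is the Borel one. *)

Section rV_measurable.
Context {R : realType} {n : nat}.

Definition rV_coord (i : 'I_n) (x : 'rV[R]_n) : measurableTypeR R := x ord0 i.

Definition rV_measurable : set (set 'rV[R]_n) := g_sigma_preimage rV_coord.

Let rV_measurable0 : rV_measurable set0.
Proof. exact: sigma_algebra0. Qed.

Let rV_measurableC A : rV_measurable A -> rV_measurable (~` A).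
Proof. exact: sigma_algebraC. Qed.

Let rV_measurable_bigcup (F : (set 'rV[R]_n)^nat) :
  (forall i, rV_measurable (F i)) -> rV_measurable (\bigcup_i F i).
Proof. exact: sigma_algebra_bigcup. Qed.

HB.instance Definition _ := @isMeasurable.Build default_measure_display
  'rV[R]_n rV_measurable rV_measurable0 rV_measurableC rV_measurable_bigcup.

End rV_measurable.

Section rV_lebesgue.
Context {R : realType}.

Definition rV_cons n (p : measurableTypeR R * 'rV[R]_n) : 'rV[R]_n.+1 :=
  row_mx (p.1 : R)%:M p.2.

Definition rV_uncons n (x : 'rV[R]_n.+1) : measurableTypeR R * 'rV[R]_n :=
  (x ord0 ord0, rsubmx (x : 'rV[R]_(1 + n))).

Lemma rV_consK n : cancel (@rV_cons n) (@rV_uncons n).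
Proof.
move=> [a x]; rewrite /rV_cons /rV_uncons row_mxKr /=; congr pair.
by rewrite mxE; case: splitP => // j _; rewrite (ord1 j) mxE.
Qed.

Lemma measurable_rV_coord n (i : 'I_n) :
  measurable_fun [set: 'rV[R]_n] (@rV_coord R n i).
Proof.
move=> _ Y mY; rewrite setTI; apply: sub_sigma_algebra => /=.
rewrite -bigcup_seq/=; exists i => /=; first by rewrite mem_index_enum.
by exists Y => //; rewrite setTI.
Qed.

Lemma measurable_fun_rV d (T : measurableType d) n (f : T -> 'rV[R]_n) :
  (forall i, measurable_fun [set: T] (@rV_coord R n i \o f)) ->
  measurable_fun [set: T] f.
Proof.
move=> mf; apply: (@measurability _ _ _ _ _ _
  (\big[setU/set0]_(i < n) preimage_set_system setT (@rV_coord R n i)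
    measurable)) => //.
move=> _ [A + <-]; rewrite -bigcup_seq => -[i /= _ [B mB <-]].
rewrite !setTI -comp_preimage -[X in measurable X]setTI.
exact: mf.
Qed.

Lemma measurable_rV_cons n : measurable_fun setT (@rV_cons n).
Proof.
apply: measurable_fun_rV => i.
have [j ->|k ->] := @split_ordP 1 n i.
  rewrite (_ : _ \o _ = fst) //; apply/funext => -[a x] /=.
  rewrite /rV_coord; apply: etrans (row_mxEl _ _ _ _) _.
  by rewrite (ord1 j) mxE.
rewrite (_ : _ \o _ = @rV_coord R n k \o snd).
  exact: measurableT_comp (@measurable_rV_coord n k) _.
by apply/funext => -[a x] /=; exact: row_mxEr.
Qed.

Lemma measurable_rV_uncons n : measurable_fun setT (@rV_uncons n).
Proof.
apply/measurable_fun_pair.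
  exact: (@measurable_rV_coord n.+1 ord0).
apply: measurable_fun_rV => i.
rewrite (_ : _ \o _ = @rV_coord R n.+1 (rshift 1 i)).
  exact: measurable_rV_coord.
by apply/funext => x /=; rewrite /rV_coord mxE.
Qed.

Lemma product_sigma_finite d1 d2 (T1 : measurableType d1)
    (T2 : measurableType d2) (m1 : {sigma_finite_measure set T1 -> \bar R})
    (m2 : {sigma_finite_measure set T2 -> \bar R}) :
  sigma_finite setT (m1 \x m2)%E.
Proof.
have /sigma_finiteP[F [TF ndF Foo]] := sigma_finiteT m1.
have /sigma_finiteP[G [TG ndG Goo]] := sigma_finiteT m2.
exists (fun n => F n `*` G n).
  rewrite -setXTT TF TG predeqE => -[x y]; split.
    move=> [/= [n _ Fnx] [k _ Gky]]; exists (maxn n k) => //; split.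
    - by move: x Fnx; exact/subsetPset/ndF/leq_maxl.
    - by move: y Gky; exact/subsetPset/ndG/leq_maxr.
  by move=> [n _ []/= ? ?]; split; exists n.
move=> k; have [? ?] := Foo k; have [? ?] := Goo k.
split; first exact: measurableX.
by rewrite product_measure1E// lte_mul_pinfty// ge0_fin_numE.
Qed.

Section step.
Context {n : nat} (mu : {sigma_finite_measure set 'rV[R]_n -> \bar R}).

Definition lebesgue_cons : set 'rV[R]_n.+1 -> \bar R :=
  pushforward (lebesgue_measure \x mu)%E (@rV_cons n).

HB.instance Definition _ := Measure.copy lebesgue_cons
  (@measure_function_pushforward__canonical__measure_function_Measure
     _ _ _ _ _ (lebesgue_measure \x mu)%E _ (@measurable_rV_cons n)).

Let lebesgue_cons_sigma_finite : sigma_finite setT lebesgue_cons.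
Proof.
have [F FT mF] : sigma_finite setT (lebesgue_measure \x mu)%E.
  exact: product_sigma_finite.
exists (fun k => @rV_uncons n @^-1` F k).
  by rewrite -preimage_bigcup -FT preimage_setT.
move=> k; have [mFk Fk] := mF k; split.
  rewrite -[X in measurable X]setTI; exact: measurable_rV_uncons.
rewrite /lebesgue_cons /pushforward -comp_preimage.
by rewrite (_ : _ \o _ = id) //; apply/funext => p /=; rewrite rV_consK.
Qed.

HB.instance Definition _ := Measure_isSigmaFinite.Build _ _ _ lebesgue_cons
  lebesgue_cons_sigma_finite.

End step.

(* Lebesgue measure on R^n, as an iterated product; a point mass for n = 0. *)
Fixpoint rV_lebesgue_measure n :
    {sigma_finite_measure set 'rV[R]_n -> \bar R} :=
  match n with
  | 0 => [the {sigma_finite_measure set 'rV[R]_0 -> \bar R} of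
           dirac (0 : 'rV[R]_0)]
  | n.+1 => [the {sigma_finite_measure set 'rV[R]_n.+1 -> \bar R} of
              lebesgue_cons (rV_lebesgue_measure n)]
  end.

End rV_lebesgue.

Notation leb n := (rV_lebesgue_measure n).

Definition partial {R : realType} {n : nat} (i : 'I_n) (f : 'rV[R]_n -> R) :
    'rV[R]_n -> R :=
  fun x => 'D_(delta_mx ord0 i) f x.

(* Only meaningful for open U: the derivatives are two-sided. *)
Fixpoint Ck {R : realType} {n : nat} (k : nat) (U : set 'rV[R]_n)
    (f : 'rV[R]_n -> R) : Prop :=
  (forall x, U x -> {for x, continuous f}) /\
  match k with
  | 0 => True
  | k'.+1 => forall i : 'I_n,
      (forall x, U x -> derivable f x (delta_mx ord0 i)) /\
      Ck k' U (partial i f)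
  end.

Definition Cinfty {R : realType} {n : nat} (U : set 'rV[R]_n)
    (f : 'rV[R]_n -> R) : Prop := forall k, Ck k U f.

(* For open Om this is the topological boundary. *)
Definition bdry {R : realType} {n : nat} (Om : set 'rV[R]_n) : set 'rV[R]_n :=
  closure Om `\` Om.

Definition bounded_domain {R : realType} {n : nat} (Om : set 'rV[R]_n) : Prop :=
  [/\ open Om, Om !=set0, connected Om & bounded_set Om].

(* Near each boundary point, up to reordering and reflecting the axes, the open
   set is the region above the graph of a C^infty function of the other
   coordinates. *)
Definition smooth_boundary {R : realType} {m : nat} (Om : set 'rV[R]_m.+1) :
    Prop :=
  forall x0, bdry Om x0 ->
  exists (k : 'I_m.+1) (s : bool) (gam : 'rV[R]_m -> R),
    Cinfty setT gam /\
    \forall x \near x0, Om x <-> gam (col' k x) < (-1) ^+ s * x ord0 k.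

(* C^{k,alpha}; f is a function on the closure of Om, given as a total function
   whose values elsewhere are irrelevant, and h is the continuous extension of
   the partial derivative to the closure. *)
Fixpoint holder {R : realType} {n : nat} (k : nat) (alpha : R)
    (Om : set 'rV[R]_n) (f : 'rV[R]_n -> R) : Prop :=
  {within closure Om, continuous f} /\
  match k with
  | 0 => exists C : R, forall x y, closure Om x -> closure Om y ->
      `|f x - f y| <= C * `|x - y| `^ alpha
  | k'.+1 => forall i : 'I_n,
      (forall x, Om x -> derivable f x (delta_mx ord0 i)) /\
      exists h : 'rV[R]_n -> R,
        (forall x, Om x -> h x = partial i f x) /\ holder k' alpha Om h
  end.

(* C^k functions on the boundary: locally restrictions of C^k functions of n
   variables. *)
Definition Ck_bdry {R : realType} {n : nat} (k : nat) (Om : set 'rV[R]_n)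
    (g : 'rV[R]_n -> R) : Prop :=
  forall x0, bdry Om x0 ->
  exists (U : set 'rV[R]_n) (G : 'rV[R]_n -> R),
    [/\ open U, U x0, Ck k U G & forall x, U x -> bdry Om x -> g x = G x].

Definition test_function {R : realType} {n : nat} (Om : set 'rV[R]_n)
    (phi : 'rV[R]_n -> R) : Prop :=
  [/\ Cinfty setT phi, compact (closure [set x | phi x != 0]) &
      closure [set x | phi x != 0] `<=` Om].

Definition locally_integrable_in {R : realType} {n : nat} (Om : set 'rV[R]_n)
    (u : 'rV[R]_n -> R) : Prop :=
  forall K, compact K -> K `<=` Om -> (leb n).-integrable K (EFin \o u).

Definition weak_partial {R : realType} {n : nat} (Om : set 'rV[R]_n) (i : 'I_n)
    (u w : 'rV[R]_n -> R) : Prop :=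
  [/\ locally_integrable_in Om u, locally_integrable_in Om w &
      forall phi, test_function Om phi ->
        \int[leb n]_(x in Om) (u x * partial i phi x) =
        - \int[leb n]_(x in Om) (w x * phi x)].

(* W^{k,p}(Om): as weak derivatives are unique up to null sets, the recursion
   says that all weak derivatives of order at most k lie in L^p(Om). *)
Fixpoint sobolev {R : realType} {n : nat} (k : nat) (p : R)
    (Om : set 'rV[R]_n) (u : 'rV[R]_n -> R) : Prop :=
  (u \_ Om) \in Lfun (leb n) p%:E /\
  match k with
  | 0 => True
  | k'.+1 => forall i : 'I_n, exists w : 'rV[R]_n -> R,
      weak_partial Om i u w /\ sobolev k' p Om w
  end.

(* L is any representative: it is determined by u up to null sets. *)
Definition weak_laplacian {R : realType} {n : nat} (Om : set 'rV[R]_n)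
    (u L : 'rV[R]_n -> R) : Prop :=
  exists d h : 'I_n -> 'rV[R]_n -> R,
    (forall i, weak_partial Om i u (d i) /\ weak_partial Om i (d i) (h i)) /\
    (forall x, Om x -> L x = \sum_i h i x).

Definition ae_in {R : realType} {n : nat} (U : set 'rV[R]_n)
    (P : 'rV[R]_n -> Prop) : Prop :=
  {ae leb n, forall x, U x -> P x}.

(* Elements of W^{2,p} for all finite p have a representative continuous up to
   the boundary; u denotes that representative. *)
Definition strong_class {R : realType} {n : nat} (Om : set 'rV[R]_n)
    (u : 'rV[R]_n -> R) : Prop :=
  {within closure Om, continuous u} /\
  forall p : R, 1 <= p -> sobolev 2 p Om u.

(* Strong solutions of
     min(-Lap u1 + f1, u1 - u2 + psi1) = 0,
     min(-Lap u2 + f2, u2 - u1 + psi2) = 0 in the domain,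
     u1 = g1, u2 = g2 on its boundary;
   L1, L2 are the Laplacians of u1, u2. Each equation min(A, B) = 0 is read as:
   B >= 0 pointwise, A >= 0 a.e., and A = 0 a.e. near each point where B > 0. *)
Definition two_system {R : realType} {n : nat} (Om : set 'rV[R]_n)
    (f1 f2 psi1 psi2 g1 g2 u1 u2 L1 L2 : 'rV[R]_n -> R) : Prop :=
  (strong_class Om u1 /\ strong_class Om u2) /\
  (weak_laplacian Om u1 L1 /\ weak_laplacian Om u2 L2) /\
  (forall x, Om x ->
     0 <= u1 x - u2 x + psi1 x /\ 0 <= u2 x - u1 x + psi2 x) /\
  (forall x, Om x -> 0 < u1 x - u2 x + psi1 x ->
     exists2 U, nbhs x U & ae_in U (fun y => L1 y = f1 y)) /\
  (forall x, Om x -> 0 < u2 x - u1 x + psi2 x ->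
     exists2 U, nbhs x U & ae_in U (fun y => L2 y = f2 y)) /\
  ae_in Om (fun x => 0 <= - L1 x + f1 x /\ 0 <= - L2 x + f2 x) /\
  (forall x, bdry Om x -> u1 x = g1 x /\ u2 x = g2 x).

Definition solves_two_system {R : realType} {n : nat} (Om : set 'rV[R]_n)
    (f1 f2 psi1 psi2 g1 g2 u1 u2 : 'rV[R]_n -> R) : Prop :=
  exists L1 L2, two_system Om f1 f2 psi1 psi2 g1 g2 u1 u2 L1 L2.

Definition solves_three_system {R : realType} {n : nat} (Om : set 'rV[R]_n)
    (f1 f2 psi1 psi2 g1 g2 u1 u2 : 'rV[R]_n -> R) : Prop :=
  exists L1 L2, two_system Om f1 f2 psi1 psi2 g1 g2 u1 u2 L1 L2 /\
    ae_in Om (fun x => Num.min (- L1 x + f1 x) (- L2 x + f2 x) = 0).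

Definition minimal_solution_two_system {R : realType} {n : nat}
    (Om : set 'rV[R]_n)
    (f1 f2 psi1 psi2 g1 g2 u1 u2 : 'rV[R]_n -> R) : Prop :=
  solves_two_system Om f1 f2 psi1 psi2 g1 g2 u1 u2 /\
  forall v1 v2, solves_two_system Om f1 f2 psi1 psi2 g1 g2 v1 v2 ->
    forall x, Om x -> u1 x <= v1 x /\ u2 x <= v2 x.

(* Main.v *)
Require Import Defs.
From mathcomp Require Import all_boot all_order all_algebra.
From mathcomp Require Import all_classical all_reals all_analysis.
From mathcomp Require Import measurable_realfun.
From mathcomp Require Import ring lra.

Set Implicit Arguments.
Unset Strict Implicit.
Unset Printing Implicit Defensive.
Import Order.TTheory GRing.Theory Num.Theory.
Import numFieldNormedType.Exports.
Local Open Scope classical_set_scope.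
Local Open Scope ring_scope.

(** Two applications of the maximum principle prove minimality.

    Let [(u1, u2)] solve the three-equation system and [(v1, v2)] the
    two-equation one. First, all solutions of the two-equation system share the
    difference of their components. Where [u1 - u2 > v1 - v2] one has [u1 - u2 +
    psi1 > 0] and [v2 - v1 + psi2 > 0], because [v] and [u] satisfy the obstacle
    constraints; hence near such a point [Lap u1 = f1] and [Lap v2 = f2], while
    [Lap u2 <= f2] and [Lap v1 <= f1] almost everywhere. So [(u1 - u2) - (v1 -
    v2)] is subharmonic where it is positive, and it vanishes on the boundary:
    it is nonpositive ([two_system_difference_le]), and equality follows by
    exchanging [u] and [v].

    Consequently [w := u1 - v1 = u2 - v2] has two expressions for its Laplacian,
    [Lap u1 - Lap v1] and [Lap u2 - Lap v2], which agree a.e. The third equation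
    says that at almost every point [Lap u1 = f1] or [Lap u2 = f2]; in the first
    case the first expression is nonnegative, in the second case the second one
    is. So [w] is subharmonic on the whole domain and vanishes on the boundary,
    and [w <= 0] ([three_system_le]).

    Only the distributional meaning of the Laplacian is used: for test functions
    [phi] supported in a closed box inside the domain, the integral of [u * Lap
    phi] is that of [L * phi] ([has_lap]). Two facts about it are needed.

    - [fundamental_lemma_of_calculus_of_variations]: an integrable function on a
      box orthogonal to all test functions vanishes a.e. inside the box.
      Products of one-variable bumps converge to indicators of open boxes, and
      the pi-lambda theorem passes from boxes to measurable sets.

    - [maximum_principle], for continuous functions with nonnegative
      distributional Laplacian. If [w] were positive somewhere, then [w + eps *
      |x|^2] would have an interior maximum [x1]. Mollify [w] by a small bump
      and add a multiple of [eps * |z|^2 - (eps / 2) * |z - x1|^2]: the term in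
      [z - x1] makes the peak strict, so the sum has a maximum [z0] in the
      interior of a small box around [x1]. Its second differences at [z0] are
      nonpositive, so the integral of [w] against the Laplacian of the bump
      centred at [z0] is negative; but that integral equals the integral of [L
      >= 0] against the bump ([subharmonic_no_peak]). The quadratic terms are
      added after the mollification, so no integration by parts against them is
      required. *)

(** * A flat function and its derivatives *)

Section flat.
Context {R : realType}.

(** The family [t^-j exp (-1/t)] on [t > 0] is closed, up to linear
    combinations, under differentiation; this is why the exponent [j] is carried
    along. *)
Definition flat (j : nat) (t : R) : R :=
  if 0 < t then t ^- j * expR (- t^-1) else 0.

Lemma flat_ge0 j t : 0 <= flat j t.
Proof.
rewrite /flat; case: ifPn => // t0.
by rewrite mulr_ge0 ?expR_ge0// invr_ge0 exprn_ge0// ltW.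
Qed.

(** As [exp s >= s] for [s = 1/(k t)], taking [k]-th powers gives [exp (-1/t) <=
    (k t)^k]; with [k = j + 2] this beats the pole [t^-j] and leaves a factor
    [t^2], which is what differentiability at the origin needs. *)
Lemma flat_quadratic j t : flat j t <= j.+2%:R ^+ j.+2 * t ^+ 2.
Proof.
rewrite /flat; case: ifPn => [t0|_]; last first.
  by apply: mulr_ge0; [exact: exprn_ge0|exact: sqr_ge0].
rewrite ler_pdivrMl ?exprn_gt0// expRN -[leLHS]mul1r.
rewrite ler_pdivrMr ?expR_gt0//.
have k0 : 0 < j.+2%:R :> R by rewrite ltr0n.
rewrite [leRHS](_ : _ =
    (t * j.+2%:R * expR (t * j.+2%:R)^-1) ^+ j.+2).
  apply: exprn_ege1.
  rewrite -ler_pdivrMl ?mulr_gt0// mulr1.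
  by apply: le_trans (expR_ge1Dx _); rewrite lerDr.
have -> : expR t^-1 = expR (t * j.+2%:R)^-1 ^+ j.+2.
  by rewrite -expRM_natl invfM mulrCA divff ?gt_eqF// mulr1.
rewrite !exprMn !exprS; ring.
Qed.

Lemma is_derive_flat j (t : R) :
  is_derive t (1 : R) (flat j) (- j%:R * flat j.+1 t + flat j.+2 t).
Proof.
have [t0|t0|->] := ltgtP t 0.
- apply: (@near_eq_is_derive _ _ _ (cst 0)).
  + near=> s; rewrite /flat ifF//; apply/negbTE; rewrite -leNgt ltW//.
    by near: s; exact: lt_nbhsl.
  + by rewrite /flat ltNge (ltW t0)/= mulr0 addr0; exact: is_derive_cst.
- have tn : t != 0 by rewrite gt_eqF.
  apply: (@near_eq_is_derive R R R (fun s : R => (s^-1) ^+ j * expR (- s^-1))).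
  + near=> s; rewrite /flat ifT ?exprVn//.
    by near: s; exact: lt_nbhsr.
  + rewrite /flat !t0.
    have hV : is_derive t 1 (fun s : R => s^-1) (- t ^- 2).
      apply: DeriveDef; first exact: derivableV.
      by rewrite (@deriveV _ _ id)// derive_id /GRing.scale/= mulr1.
    have hX : is_derive t 1 (fun s : R => s^-1 ^+ j)
        (j%:R * t^-1 ^+ j.-1 * (- t ^- 2)).
      by have := is_deriveX j hV; rewrite exprfctE.
    have hE : is_derive t 1 (fun s : R => expR (- s^-1))
        (expR (- t^-1) * t ^- 2).
      have hN : is_derive t (1 : R) (fun s : R => - s^-1) (t ^- 2).
        by have := is_deriveN hV; rewrite opprK.
      exact: is_derive1_comp.
    have hM := is_deriveM hX hE.
    apply: (@is_derive_eq R R R _ _ _ _ _ hM).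
    rewrite /GRing.scale/= -!exprVn.
    case: j {hX hM} => [|j] /=; first by ring.
    rewrite !exprS !expr0; ring.
- have flat0 k : flat k 0 = 0 by rewrite /flat ltxx.
  rewrite !flat0 mulr0 addr0.
  suff h : (fun h : R => h^-1 *: ((flat j \o shift 0) (h *: 1) - flat j 0))
      @ 0^' --> (0 : R).
    by apply: DeriveDef; [apply/cvg_ex; exists 0|exact: cvg_lim].
  set C := j.+2%:R ^+ j.+2 : R.
  have C0 : 0 <= C by rewrite exprn_ge0.
  apply/cvgrPdist_le => /= e e0; near=> h.
  have hn : h != 0 by near: h; exact: nbhs_dnbhs_neq.
  rewrite sub0r normrN flat0 subr0 addr0 [h *: 1]mulr1 [_ *: _]mulrC.
  rewrite normrM normfV ler_pdivrMr ?normr_gt0// ger0_norm ?flat_ge0//.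
  apply: le_trans (flat_quadratic _ _) _; rewrite -/C -real_normK ?num_real//.
  rewrite expr2 mulrA ler_wpM2r//.
  have : `|h| <= e / (C + 1).
    near: h; apply: dnbhs0_le; rewrite divr_gt0// ltr_wpDl//.
  rewrite ler_pdivlMr ?ltr_wpDl// => /(le_trans _); apply.
  by rewrite mulrC ler_wpM2l// lerDl.
Unshelve. all: by end_near.
Qed.

End flat.

(** * A class of smooth functions closed under differentiation *)

Section smooth.
Context {R : realType} {n : nat}.
Implicit Types (f g : 'rV[R]_n -> R) (x y z : 'rV[R]_n).

(** An inductively generated class instead of a general notion of smoothness:
    each generator has partial derivatives that are again in the class, so that
    infinite differentiability follows by induction on the derivation. *)
Inductive smooth : ('rV[R]_n -> R) -> Prop :=
| smooth_cst c : smooth (fun=> c)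
| smooth_coord i : smooth (fun x => x ord0 i)
| smoothD f g : smooth f -> smooth g -> smooth (fun x => f x + g x)
| smoothM f g : smooth f -> smooth g -> smooth (fun x => f x * g x)
| smooth_flat j f : smooth f -> smooth (fun x => flat j (f x)).

Lemma smooth_differentiable f : smooth f -> forall x, differentiable f x.
Proof.
elim=> {f} [c x|i x|f g _ fd _ gd x|f g _ fd _ gd x|j f _ fd x].
- exact: differentiable_cst.
- exact: differentiable_coord.
- exact: differentiableD.
- exact: differentiableM.
- apply: (@differentiable_comp _ _ _ _ f (flat j)) => //.
  by apply/derivable1_diffP; have [] := is_derive_flat j (f x).
Qed.

Lemma smooth_derivable f x v : smooth f -> derivable f x v.
Proof. by move=> /smooth_differentiable fd; exact/diff_derivable. Qed.

Lemma smooth_continuous f : smooth f -> continuous f.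
Proof.
by move=> /smooth_differentiable fd x; exact/differentiable_continuous.
Qed.

Lemma derive_coord x v i : 'D_v (fun y : 'rV[R]_n => y ord0 i) x = v ord0 i.
Proof.
have dI : derivable (id : 'rV[R]_n -> 'rV[R]_n) x v by exact: derivable_id.
have /= := derive_mx dI.
by rewrite derive_id => /matrixP/(_ ord0 i); rewrite mxE.
Qed.

Lemma derive_flat_comp j f x v : differentiable f x ->
  'D_v (fun y => flat j (f y)) x =
  (- j%:R * flat j.+1 (f x) + flat j.+2 (f x)) * 'D_v f x.
Proof.
move=> fx; have [fl flE] := is_derive_flat j (f x).
have flx : differentiable (flat j) (f x) by exact/derivable1_diffP.
rewrite (@deriveE _ _ _ (flat j \o f)); last exact: differentiable_comp.
rewrite diff_comp//= diff1E// derive1E flE (deriveE _ fx).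
by rewrite /GRing.scale/= mulrC.
Qed.

Lemma smooth_partial i f : smooth f -> smooth (partial i f).
Proof.
elim=> {f} [c|k|f g sf IHf sg IHg|f g sf IHf sg IHg|j f sf IH].
- rewrite (_ : partial _ _ = fun=> 0); first exact: smooth_cst.
  by apply/funext => x; exact: derive_cst.
- rewrite (_ : partial _ _ = fun=> (delta_mx ord0 i : 'rV[R]_n) ord0 k).
    exact: smooth_cst.
  by apply/funext => x; exact: derive_coord.
- rewrite (_ : partial _ _ = fun x => partial i f x + partial i g x).
    exact: smoothD.
  by apply/funext => x; apply: deriveD; exact: smooth_derivable.
- rewrite (_ : partial _ _ = fun x => f x * partial i g x + g x * partial i f x).
    by apply: smoothD; exact: smoothM.
  by apply/funext => x; apply: deriveM; exact: smooth_derivable.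
- rewrite (_ : partial _ _ = fun x =>
    (- j%:R * flat j.+1 (f x) + flat j.+2 (f x)) * partial i f x).
    apply: smoothM => //; apply: smoothD; last exact: smooth_flat.
    by apply: smoothM; [exact: smooth_cst|exact: smooth_flat].
  apply/funext => x; apply: derive_flat_comp; exact: smooth_differentiable.
Qed.

Lemma smooth_Cinfty f : smooth f -> Cinfty setT f.
Proof.
move=> sf k; elim: k f sf => [|k IH] f sf.
  by split=> // x _; exact: smooth_continuous.
split=> [x _|i]; first exact: smooth_continuous.
by split=> [x _|]; [exact: smooth_derivable|exact/IH/smooth_partial].
Qed.

Lemma smooth_prod (I : Type) (r : seq I) (F : I -> 'rV[R]_n -> R) :
  (forall i, smooth (F i)) -> smooth (fun x => \prod_(i <- r) F i x).
Proof.
move=> sF; elim: r => [|i r IH].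
  by under eq_fun do rewrite big_nil; exact: smooth_cst.
by under eq_fun do rewrite big_cons; exact: smoothM.
Qed.

Lemma smooth_translate z f : smooth f -> smooth (fun x => f (x - z)).
Proof.
elim=> {f} [c|i|f g sf IHf sg IHg|f g sf IHf sg IHg|j f sf IH].
- exact: smooth_cst.
- rewrite (_ : (fun x => _) = fun x : 'rV[R]_n => x ord0 i + - z ord0 i).
    by apply: smoothD; [exact: smooth_coord|exact: smooth_cst].
  by apply/funext => x; rewrite !mxE.
- exact: smoothD.
- exact: smoothM.
- exact: smooth_flat.
Qed.

Lemma partial_translate i z f :
  partial i (fun x => f (x - z)) = fun x => partial i f (x - z).
Proof.
apply/funext => x; rewrite /partial /derive.
under eq_fun do rewrite /= -addrA.
by [].
Qed.

Lemma is_derive_line i f x (s : R) : smooth f ->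
  is_derive s (1 : R) (fun s => f (x + s *: delta_mx ord0 i))
    (partial i f (x + s *: delta_mx ord0 i)).
Proof.
move=> sf; set e := delta_mx _ _.
have : derivable f (x + s *: e) e by exact: smooth_derivable.
rewrite /derivable.
have E : (fun h : R => h^-1 *:
    ((f \o shift (x + s *: e)) (h *: e) - f (x + s *: e))) =
  (fun h : R => h^-1 *: (((fun s => f (x + s *: e)) \o shift s) (h *: 1)
    - f (x + s *: e))).
  apply/funext => h /=; congr (_ *: (f _ - _)).
  by rewrite scalerDl [h *: 1]mulr1 addrCA.
by move=> h; apply: DeriveDef; rewrite /derivable /partial /derive -E.
Qed.

End smooth.

Lemma MVT_le (R : realType) (g g' : R -> R) (B t : R) : 0 <= t ->
  (forall s : R, is_derive s (1 : R) g (g' s)) -> g 0 = 0 ->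
  (forall s, 0 <= s <= t -> `|g' s| <= B) -> `|g t| <= B * t.
Proof.
move=> t0 dg g0 Bg'.
have [|c] := @MVT_segment R g g' 0 t t0 (fun x _ => dg x).
- apply: derivable_within_continuous => x _.
  by have [] := dg x.
- rewrite in_itv/= => ct; rewrite g0 !subr0 => ->.
  by rewrite normrM (ger0_norm t0) ler_wpM2r// Bg'.
Qed.

(** The mean value theorem is applied three times, to the error and to its first
    two derivatives, all of which vanish at the origin. *)
Lemma second_difference_le (R : realType) (g g1 g2 g3 : R -> R) (C t : R) :
  (forall s : R, is_derive s (1 : R) g (g1 s)) ->
  (forall s : R, is_derive s (1 : R) g1 (g2 s)) ->
  (forall s : R, is_derive s (1 : R) g2 (g3 s)) ->
  (forall s : R, `|g3 s| <= C) -> 0 <= t ->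
  `|g t + g (- t) - 2 * g 0 - t ^+ 2 * g2 0| <= 2 * C * t ^+ 3.
Proof.
move=> d1 d2 d3 bC t0.
have C0 : 0 <= C by apply: le_trans (bC 0).
have dN (h h' : R -> R) (s : R) : (forall s : R, is_derive s (1 : R) h (h' s)) ->
    is_derive s (1 : R) (fun s => h (- s)) (- h' (- s)).
  move=> dh; rewrite -[- _]mulrN1.
  by apply: is_derive1_comp; exact: is_deriveNid.
pose L s := g2 s + g2 (- s) - 2 * g2 0.
pose K s := g1 s - g1 (- s) - 2 * g2 0 * s.
pose H s := g s + g (- s) - 2 * g 0 - s ^+ 2 * g2 0.
have dD (h k : R -> R) (h' k' s : R) : is_derive s (1 : R) h h' ->
    is_derive s (1 : R) k k' ->
    is_derive s (1 : R) (fun x => h x + k x) (h' + k').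
  by move=> dh dk; exact: is_deriveD.
have dZ (h : R -> R) (c h' s : R) : is_derive s (1 : R) h h' ->
    is_derive s (1 : R) (fun x => c * h x) (c * h').
  by move=> dh; exact: (is_deriveZ c dh).
have dB (h k : R -> R) (h' k' s : R) : is_derive s (1 : R) h h' ->
    is_derive s (1 : R) k k' ->
    is_derive s (1 : R) (fun x => h x - k x) (h' - k').
  by move=> dh dk; exact: is_deriveB.
have dC (c s : R) : is_derive s (1 : R) (fun=> c) 0 by exact: is_derive_cst.
have dI (s : R) : is_derive s (1 : R) (fun x => x) 1 by exact: is_derive_id.
have dL (s : R) : is_derive s (1 : R) L (g3 s - g3 (- s)).
  rewrite -[_ - g3 _]subr0; exact: dB.
have dK (s : R) : is_derive s (1 : R) K (L s).
  rewrite /L -[g2 (- s)]opprK -[2 * g2 0]mulr1.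
  by apply: dB.
have dH (s : R) : is_derive s (1 : R) H (K s).
  rewrite /K -[X in X - _]subr0; apply: dB.
  rewrite (_ : (fun x => _) = fun x : R => g2 0 * x ^+ 2); last first.
    by apply/funext => x; rewrite mulrC.
  rewrite -mulrA mulrCA; apply: dZ.
  have := is_deriveX 2 (dI s); rewrite exprfctE /= expr1.
  by rewrite /GRing.scale/= mulr1.
have bL s : 0 <= s -> `|L s| <= 2 * C * s.
  move=> s0; apply: (MVT_le s0 dL); first by rewrite /L oppr0; ring.
  move=> r _; apply: le_trans (ler_normB _ _) _.
  by rewrite mulr_natl mulr2n lerD.
have bK s : 0 <= s -> `|K s| <= 2 * C * s * s.
  move=> s0; apply: (MVT_le s0 dK); first by rewrite /K oppr0; ring.
  move=> r /andP[r0 rs]; apply: le_trans (bL _ r0) _.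
  by rewrite ler_wpM2l// mulr_ge0.
rewrite -/(H t) (_ : 2 * C * _ = 2 * C * t * t * t); last by ring.
apply: (MVT_le t0 dH); first by rewrite /H oppr0; ring.
move=> r /andP[r0 rt]; apply: le_trans (bK _ r0) _.
by rewrite ler_pM// ?mulr_ge0// ler_wpM2l// mulr_ge0.
Qed.

(** * Boxes and Lebesgue measure *)

Section boxes.
Context {R : realType} {n : nat}.
Implicit Types (a b x y z : 'rV[R]_n).

(** Boxes play the role of balls: they are the balls of the sup norm, they are
    products of intervals, and bumps supported in them are products. *)
Definition cbox a b : set 'rV[R]_n :=
  [set x | forall i, a ord0 i <= x ord0 i <= b ord0 i].

Definition obox a b : set 'rV[R]_n :=
  [set x | forall i, a ord0 i < x ord0 i < b ord0 i].

Lemma obox_cbox a b : obox a b `<=` cbox a b.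
Proof. by move=> x + i => /(_ i)/andP[? ?]; rewrite !ltW. Qed.

Lemma cboxE a b :
  cbox a b = [set x | forall i, [set` `[a ord0 i, b ord0 i]] (x ord0 i)].
Proof.
by apply/seteqP; split=> x /= h i; have := h i; rewrite in_itv.
Qed.

Lemma oboxE a b :
  obox a b = [set x | forall i, [set` `]a ord0 i, b ord0 i[] (x ord0 i)].
Proof.
by apply/seteqP; split=> x /= h i; have := h i; rewrite in_itv.
Qed.

Lemma compact_cbox a b : compact (cbox a b).
Proof.
rewrite cboxE.
apply: (@rV_compact R n (fun i => [set` `[a ord0 i, b ord0 i]])) => i.
exact: segment_compact.
Qed.

Lemma closed_cbox a b : closed (cbox a b).
Proof.
by apply: compact_closed; [exact: norm_hausdorff|exact: compact_cbox].
Qed.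

Lemma measurable_coord_preimage i (B : set (measurableTypeR R)) :
  measurable B -> measurable [set x : 'rV[R]_n | B (x ord0 i)].
Proof.
move=> mB; rewrite -[X in measurable X]setTI.
exact: (@measurable_rV_coord R n i measurableT).
Qed.

Lemma measurable_coord_forall (B : 'I_n -> set (measurableTypeR R)) :
  (forall i, measurable (B i)) ->
  measurable [set x : 'rV[R]_n | forall i, B i (x ord0 i)].
Proof.
move=> mB; rewrite (_ : mkset _ =
    \big[setI/setT]_(i < n) [set x : 'rV[R]_n | B i (x ord0 i)]).
  by apply: bigsetI_measurable => i _; exact: measurable_coord_preimage.
rewrite -bigcap_seq; apply/seteqP; split=> x /= h.
  by move=> i _; exact: h.
by move=> i; apply: h => /=; exact: mem_index_enum.
Qed.

Lemma measurable_cbox a b : measurable (cbox a b).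
Proof.
rewrite cboxE; apply: (@measurable_coord_forall
  (fun i => [set` `[a ord0 i, b ord0 i]])) => i.
exact: measurable_itv.
Qed.

Lemma measurable_obox a b : measurable (obox a b).
Proof.
rewrite oboxE; apply: (@measurable_coord_forall
  (fun i => [set` `]a ord0 i, b ord0 i[])) => i.
exact: measurable_itv.
Qed.

Lemma mx_norm_leP x (r : R) : 0 <= r ->
  `|x| <= r <-> forall i, `|x ord0 i| <= r.
Proof.
move=> r0; have -> : `|x| = \big[Num.max/0]_ij `|x ij.1 ij.2|.
  by rewrite {1}/Num.Def.normr/= mx_normrE.
split=> [h i|h].
  by apply: le_trans h; exact: (le_bigmax _ _ (ord0, i)).
by apply/bigmax_leP; split=> // -[i j] _ /=; rewrite ord1.
Qed.

Lemma cbox_ballE x (r : R) : 0 <= r ->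
  cbox (x - const_mx r) (x + const_mx r) = [set y | `|y - x| <= r].
Proof.
move=> r0; apply/seteqP; split=> y /= h.
  by apply/(mx_norm_leP _ r0) => i; have := h i; rewrite !mxE ler_norml; lra.
by move=> i; have /(mx_norm_leP _ r0)/(_ i) := h; rewrite !mxE ler_norml; lra.
Qed.

Lemma nbhs_cbox x (U : set 'rV[R]_n) : nbhs x U ->
  exists2 r : R, 0 < r & cbox (x - const_mx r) (x + const_mx r) `<=` U.
Proof.
move=> /nbhs_ballP[r /= r0 rU]; exists (r / 2); first by rewrite divr_gt0.
rewrite cbox_ballE; last by rewrite divr_ge0// ltW.
move=> y /= yx; apply: rU; rewrite -ball_normE/= distrC.
by apply: le_lt_trans yx _; rewrite ltr_pdivrMr// ltr_pMr// ltr1n.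
Qed.

End boxes.

Section lebesgue.
Context {R : realType}.

Lemma ge0_integral_rV_consE n (f : 'rV[R]_n.+1 -> \bar R) :
  measurable_fun [set: 'rV[R]_n.+1] f -> (forall x, (0 <= f x)%E) ->
  (\int[leb n.+1]_x f x =
   \int[lebesgue_measure]_t \int[leb n]_x f (rV_cons (t, x)))%E.
Proof.
move=> mf f0.
rewrite -[LHS]/(\int[pushforward (lebesgue_measure \x leb n)
  (@rV_cons R n)]_x f x)%E.
rewrite ge0_integral_pushforward//; last exact: measurable_rV_cons.
rewrite preimage_setT fubini_tonelli1//.
- by apply: measurableT_comp => //; exact: measurable_rV_cons.
- by move=> x; exact: f0.
Qed.

Lemma rV_cons_head n (t : R) (x : 'rV[R]_n) :
  rV_cons (t, x) ord0 ord0 = t.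
Proof. by have [] : rV_uncons (rV_cons (t, x)) = (t, x) by rewrite rV_consK. Qed.

Lemma rV_cons_tail n (t : R) (x : 'rV[R]_n) i :
  rV_cons (t, x) ord0 (lift ord0 i) = x ord0 i.
Proof.
have -> : lift ord0 i = rshift 1 i by exact/val_inj.
exact: (@row_mxEr R 1 1 n).
Qed.

(** Induction on the dimension, through the definition of the measure as the
    image of a product under the map that prepends a coordinate. *)
Lemma leb_rect n (B : 'I_n -> set (measurableTypeR R)) :
  (forall i, measurable (B i)) ->
  leb n [set x : 'rV[R]_n | forall i, B i (x ord0 i)] =
  (\prod_(i < n) lebesgue_measure (B i))%E.
Proof.
elim: n B => [|n IH] B mB.
  rewrite big_ord0 (_ : mkset _ = setT); last first.
    by apply/seteqP; split=> // x _ [].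
  by rewrite /= diracT.
rewrite big_ord_recl -IH//.
rewrite -product_measure1E//; last first.
  exact: (@measurable_coord_forall R n (fun i => B (lift ord0 i))).
rewrite -[LHS]/((lebesgue_measure \x leb n)%E (@rV_cons R n @^-1` _)).
congr ((_ \x _)%E _); apply/seteqP; split=> -[t x] /=.
  move=> h; split; first by have := h ord0; rewrite rV_cons_head.
  by move=> i; have := h (lift ord0 i); rewrite rV_cons_tail.
move=> [ht hx] i; case: (unliftP ord0 i) => [j ->|->].
  by rewrite rV_cons_tail.
by rewrite rV_cons_head.
Qed.

Lemma leb_cbox_lty n (a b : 'rV[R]_n) : (leb n (cbox a b) < +oo)%E.
Proof.
rewrite cboxE (@leb_rect n (fun i => [set` `[a ord0 i, b ord0 i]])); last first.
  by move=> i; exact: measurable_itv.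
suff : (\prod_(i < n) lebesgue_measure [set` `[a ord0 i, b ord0 i]])%E
  \is a fin_num by rewrite fin_numE -ltey => /andP[_].
elim/big_ind : _ => [//|x y|i _]; first exact: fin_numM.
by rewrite lebesgue_measure_itv/=; case: ifPn.
Qed.

Lemma leb_obox_gt0 n (a b : 'rV[R]_n) : (forall i, a ord0 i < b ord0 i) ->
  (0 < leb n (obox a b))%E.
Proof.
move=> ab.
rewrite oboxE (@leb_rect n (fun i => [set` `]a ord0 i, b ord0 i[])); last first.
  by move=> i; exact: measurable_itv.
elim/big_ind : _ => [//|x y|i _]; first exact: mule_gt0.
rewrite lebesgue_measure_itv/= lte_fin ab.
by rewrite -EFinB lte_fin subr_gt0.
Qed.

Lemma ge0_integral_translate1 (f : R -> \bar R) (z : R) :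
  measurable_fun [set: measurableTypeR R] f -> (forall x, (0 <= f x)%E) ->
  (\int[lebesgue_measure]_(t in [set: R]) f (t + z)%R =
   \int[lebesgue_measure]_t f t)%E.
Proof.
move=> mf f0.
pose s : R -> measurableTypeR R := fun t => t + z.
have ms : measurable_fun setT s by exact: measurable_funD.
rewrite -[LHS](@ge0_integral_pushforward _ _ (measurableTypeR R)
  (measurableTypeR R) R s ms lebesgue_measure setT f)//.
apply: eq_measure_integral => // A mA _.
apply/esym/lebesgue_measure_unique => // _ [[a b]] _ <-.
rewrite /= /pushforward (_ : _ @^-1` _ = `]a - z, b - z]%classic).
  rewrite !lebesgue_measure_itv/= !lte_fin ltrD2r; case: ifPn => // _.
  by rewrite -!EFinB opprB addrA subrK.
by apply/seteqP; split=> t /=; rewrite !in_itv/= /s ltrBlDr lerBrDr.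
Qed.

Lemma measurable_rV_translate n (z : 'rV[R]_n) :
  measurable_fun setT (fun x : 'rV[R]_n => x + z).
Proof.
apply: measurable_fun_rV => i.
rewrite (_ : _ \o _ = fun x => rV_coord i x + z ord0 i); last first.
  by apply/funext => x; rewrite /rV_coord/= mxE.
by apply: measurable_funD => //; exact: measurable_rV_coord.
Qed.

(** Tonelli reduces the invariance to dimension one. *)
Lemma ge0_integral_translate n (f : 'rV[R]_n -> \bar R) (z : 'rV[R]_n) :
  measurable_fun [set: 'rV[R]_n] f -> (forall x, (0 <= f x)%E) ->
  (\int[leb n]_x f (x + z)%R = \int[leb n]_x f x)%E.
Proof.
elim: n f z => [|n IH] f z mf f0.
  by apply: eq_integral => x _; congr f; apply/rowP => -[].
rewrite ge0_integral_rV_consE//; last first.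
  by apply: measurableT_comp => //; exact: measurable_rV_translate.
rewrite ge0_integral_rV_consE//.
have mfc : measurable_fun setT (f \o @rV_cons R n).
  by apply: measurableT_comp => //; exact: measurable_rV_cons.
pose F (t : measurableTypeR R) := (\int[leb n]_x f (rV_cons (t, x)))%E.
have mF : measurable_fun setT F.
  exact: (@measurable_fun_fubini_tonelli_F _ _ (measurableTypeR R) 'rV[R]_n R
    (leb n) (f \o @rV_cons R n) mfc (fun p => f0 (rV_cons p))).
rewrite -(@ge0_integral_translate1 F (z ord0 ord0))//; last first.
  by move=> t; exact: integral_ge0.
apply: eq_integral => t _.
rewrite /F -[RHS](IH _ (rsubmx (z : 'rV[R]_(1 + n))))//; last first.
  exact: (measurableT_comp mfc (pair1_measurable (t + z ord0 ord0))).
apply: eq_integral => x _; congr f; apply/rowP => i; rewrite [LHS]mxE.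
case: (unliftP ord0 i) => [j ->|->].
  rewrite !rV_cons_tail !mxE; congr (_ + z _ _); exact/val_inj.
by rewrite !rV_cons_head.
Qed.
End lebesgue.

(** * Test functions and the distributional Laplacian *)

Section test_functions.
Context {R : realType} {n : nat}.
Implicit Types (f g : 'rV[R]_n -> R) (a b x y z : 'rV[R]_n).

Lemma measurable_smooth f : smooth f ->
  measurable_fun [set: 'rV[R]_n] (f : 'rV[R]_n -> measurableTypeR R).
Proof.
elim=> {f} [c|k|f g sf IHf sg IHg|f g sf IHf sg IHg|j f sf IH].
- exact: measurable_cst.
- exact: (@measurable_rV_coord R n k).
- exact: measurable_funD.
- exact: measurable_funM.
- apply: (@measurableT_comp _ _ _ _ _ _
    (flat j : measurableTypeR R -> measurableTypeR R)) => //.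
  apply: continuous_measurable_fun => t.
  apply/differentiable_continuous/derivable1_diffP.
  by have [] := is_derive_flat j t.
Qed.

(** A support condition relative to a closed box, stable under differentiation
    because the complement of the box is open. *)
Definition vanishes_off a b f := forall x, ~ cbox a b x -> f x = 0.

Lemma vanishes_off_partial a b i f :
  vanishes_off a b f -> vanishes_off a b (partial i f).
Proof.
move=> f0 x xab; rewrite /partial (@near_eq_derive _ _ _ f (cst 0)).
  exact: derive_cst.
have : open (~` cbox a b) by exact/closed_openC/closed_cbox.
move=> ox; apply: filterS (open_nbhs_nbhs (conj ox xab)) => y; exact: f0.
Qed.

Lemma vanishes_off_mull a b f g :
  vanishes_off a b f -> vanishes_off a b (fun x => g x * f x).
Proof. by move=> f0 x /f0 ->; rewrite mulr0. Qed.

Lemma smooth_bounded a b f : smooth f -> vanishes_off a b f ->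
  exists2 C, 0 <= C & forall x, `|f x| <= C.
Proof.
move=> sf f0.
have [c|ne] := pselect (cbox a b !=set0); last first.
  by exists 0 => // x; rewrite f0 ?normr0// => h; apply: ne; exists x.
have cf : {within cbox a b, continuous (fun x => `|f x|)}.
  apply: continuous_subspaceT => x.
  by apply: continuous_comp; [exact: smooth_continuous|exact: norm_continuous].
have [y _ fy] := EVT_max_rV c (@compact_cbox _ _ a b) cf.
exists `|f y| => // x; have [xab|xab] := pselect (cbox a b x).
  by apply: fy; rewrite inE.
by rewrite f0// normr0.
Qed.

Lemma test_function_smooth (Om : set 'rV[R]_n) a b f :
  smooth f -> vanishes_off a b f -> cbox a b `<=` Om -> test_function Om f.
Proof.
move=> sf f0 abOm.
have sub : closure [set x | f x != 0] `<=` cbox a b.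
  rewrite closureE; apply: bigcap_inf; split; first exact: closed_cbox.
  move=> x /= fx; apply: contrapT => /f0 fx0.
  by rewrite fx0 eqxx in fx.
split; first exact: smooth_Cinfty.
- apply: subclosed_compact (@compact_cbox _ _ a b) sub.
  exact: closed_closure.
- exact: subset_trans sub abOm.
Qed.

Definition lap f x := \sum_i partial i (partial i f) x.

Lemma smooth_lap f : smooth f -> smooth (lap f).
Proof.
rewrite /lap => sf; elim: (index_enum _) => [|i r IH].
  by under eq_fun do rewrite big_nil; exact: smooth_cst.
under eq_fun do rewrite big_cons.
by apply: smoothD => //; do 2!apply: smooth_partial.
Qed.

Lemma vanishes_off_lap a b f : vanishes_off a b f -> vanishes_off a b (lap f).
Proof.
move=> f0 x xab; rewrite /lap big1// => i _.
exact: (@vanishes_off_partial _ _ i _ (@vanishes_off_partial _ _ i _ f0)).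
Qed.

Lemma integrable_mul_smooth a b (D : set 'rV[R]_n) u f : measurable D ->
  (leb n).-integrable D (EFin \o u) -> smooth f -> vanishes_off a b f ->
  (leb n).-integrable D (EFin \o (fun x => u x * f x)).
Proof.
move=> mD iu sf f0; have [C C0 fC] := smooth_bounded sf f0.
apply: (integrableMl (h := f) mD iu).
  by apply: measurable_funTS; exact: measurable_smooth.
exists C; split; first exact: num_real.
by move=> M CM x _; apply: le_trans (fC x) (ltW CM).
Qed.

Lemma Rintegral_vanishes_off a b (Om : set 'rV[R]_n) f :
  cbox a b `<=` Om -> vanishes_off a b f ->
  \int[leb n]_(x in Om) f x = \int[leb n]_(x in cbox a b) f x.
Proof.
move=> abOm f0; rewrite Rintegral_mkcond [RHS]Rintegral_mkcond.
congr (Rintegral _ _ _); apply/funext => x; rewrite /patch.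
have [xab|xab] := boolP (x \in cbox a b).
  by rewrite ifT//; exact/mem_set/abOm/set_mem.
by rewrite f0 ?if_same// => h; move: xab; rewrite notin_setE.
Qed.

(** [L] is the Laplacian of [u] in the sense of distributions on a box. Unlike
    weak second derivatives taken one by one, this is directly additive and
    local. *)
Definition has_lap a b u L :=
  [/\ (leb n).-integrable (cbox a b) (EFin \o u),
      (leb n).-integrable (cbox a b) (EFin \o L) &
      forall f, smooth f -> vanishes_off a b f ->
        \int[leb n]_(x in cbox a b) (u x * lap f x) =
        \int[leb n]_(x in cbox a b) (L x * f x)].

Lemma has_lapB a b u L v K : has_lap a b u L -> has_lap a b v K ->
  has_lap a b (fun x => u x - v x) (fun x => L x - K x).
Proof.
move=> [iu iL uL] [iv iK vK]; have mab := @measurable_cbox _ _ a b.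
split.
- exact: (integrableB mab iu iv).
- exact: (integrableB mab iL iK).
- move=> f sf f0; under eq_Rintegral do rewrite mulrBl.
  rewrite RintegralB//; last 2 first.
  + apply: integrable_mul_smooth => //; [exact: smooth_lap|].
    exact: vanishes_off_lap f0.
  + apply: integrable_mul_smooth => //; [exact: smooth_lap|].
    exact: vanishes_off_lap f0.
  rewrite uL// vK// -RintegralB//; [|exact: integrable_mul_smooth f0..].
  by apply: eq_Rintegral => x _; rewrite mulrBl.
Qed.

Lemma Rintegral_sum (I : Type) (r : seq I) (F : I -> 'rV[R]_n -> R) D :
  measurable D ->
  (forall i, (leb n).-integrable D (EFin \o F i)) ->
  (leb n).-integrable D (EFin \o (fun x => \sum_(i <- r) F i x)) /\
  \int[leb n]_(x in D) (\sum_(i <- r) F i x) =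
    \sum_(i <- r) \int[leb n]_(x in D) F i x.
Proof.
move=> mD iF; elim: r => [|i r [IH1 IH2]].
  have -> : (fun x => \sum_(i <- [::]) F i x) = cst 0.
    by apply/funext => x; rewrite big_nil.
  split; first exact: integrable0.
  by rewrite big_nil Rintegral_cst// mul0r.
have -> : (fun x => \sum_(j <- i :: r) F j x) =
    (fun x => F i x + \sum_(j <- r) F j x).
  by apply/funext => x; rewrite big_cons.
split; first exact: (integrableD mD (iF i) IH1).
by rewrite big_cons RintegralD// IH2.
Qed.

End test_functions.

(** Two uses of the definition of weak derivative, with the test functions [f]
    and [partial i f], for each direction. *)
Lemma weak_laplacian_has_lap (R : realType) m (Om : set 'rV[R]_m.+1) a b u L :
  weak_laplacian Om u L -> cbox a b `<=` Om -> has_lap a b u L.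
Proof.
move=> [d [h [dh LE]]] abOm.
have cab := @compact_cbox _ _ a b; have mab := @measurable_cbox _ _ a b.
have iu : (leb m.+1).-integrable (cbox a b) (EFin \o u).
  by have [[iu _ _] _] := dh ord0; exact: iu.
have ih i : (leb m.+1).-integrable (cbox a b) (EFin \o h i).
  by have [_ [_ ih _]] := dh i; exact: ih.
have [iS _] := Rintegral_sum (index_enum _) mab ih.
have iL : (leb m.+1).-integrable (cbox a b) (EFin \o L).
  apply: eq_integrable iS => //= x xab; congr EFin.
  by rewrite LE//; exact/abOm/set_mem.
split=> // f sf f0.
have step i : \int[leb m.+1]_(x in cbox a b) (u x * partial i (partial i f) x) =
    \int[leb m.+1]_(x in cbox a b) (h i x * f x).
  have [[_ _ ud] [_ _ dhi]] := dh i.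
  have tf := test_function_smooth sf f0 abOm.
  have f0' : vanishes_off a b (partial i f) by exact: vanishes_off_partial.
  have tf' := test_function_smooth (smooth_partial i sf) f0' abOm.
  rewrite -!(Rintegral_vanishes_off abOm); last 2 first.
  - exact: vanishes_off_mull.
  - exact/vanishes_off_mull/vanishes_off_partial.
  by rewrite ud// dhi// opprK.
have ihf i := integrable_mul_smooth mab (ih i) sf f0.
have iuf i : (leb m.+1).-integrable (cbox a b)
    (EFin \o (fun x => u x * partial i (partial i f) x)).
  apply: (integrable_mul_smooth mab iu).
    by do 2!apply: smooth_partial.
  exact: (@vanishes_off_partial _ _ a b i _ (@vanishes_off_partial _ _ a b i _ f0)).
rewrite /lap; under eq_Rintegral do rewrite mulr_sumr.
have [_ ->] := Rintegral_sum (index_enum _) mab iuf.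
under eq_bigr do rewrite step.
have [_ <-] := Rintegral_sum (index_enum _) mab ihf.
apply: eq_Rintegral => x xab; rewrite LE ?mulr_suml//.
exact/abOm/set_mem.
Qed.

(** * Bumps approximating the indicators of open boxes *)

Lemma flat_eq0 (R : realType) j (t : R) : t <= 0 -> flat j t = 0.
Proof. by rewrite /flat leNgt => /negbTE ->. Qed.

Lemma flat0_gt0 (R : realType) (t : R) : 0 < t -> 0 < flat 0 t.
Proof. by rewrite /flat => ->; rewrite invr1 mul1r expR_gt0. Qed.

Lemma flat0_le1 (R : realType) (t : R) : flat 0 t <= 1.
Proof.
rewrite /flat; case: ifPn => // t0.
by rewrite invr1 mul1r -expR0 ler_expR oppr_le0 invr_ge0 ltW.
Qed.

Lemma flat0_cvg1 (R : realType) (t : R) : 0 < t ->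
  (fun k => flat 0 (k.+1%:R * t)) @ \oo --> (1 : R).
Proof.
move=> t0; rewrite (_ : (fun k => _) = fun k => expR (- (k.+1%:R^-1 * t^-1))).
  rewrite -[X in _ --> X]expR0 -oppr0 -[X in - X](mul0r t^-1).
  apply: (@continuous_cvg _ _ _ _ _ _ expR); first exact: continuous_expR.
  by apply: cvgN; apply: cvgM; [exact: cvg_harmonic|exact: cvg_cst].
by apply/funext => k; rewrite /flat mulr_gt0// invr1 mul1r invfM.
Qed.

Section bump.
Context {R : realType} {n : nat}.
Implicit Types (f g : 'rV[R]_n -> R) (a b x y z : 'rV[R]_n).

(** For [k > 0] the bump is positive exactly on the open box, and tends to its
    indicator when the steepness [k] grows. Separate factors for the two faces
    keep it zero when the box is empty, whatever the order of the end points. *)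
Definition bump (k : R) a b x : R :=
  \prod_i (flat 0 (k * (x ord0 i - a ord0 i)) *
           flat 0 (k * (b ord0 i - x ord0 i))).

Lemma smooth_bump k a b : smooth (bump k a b).
Proof.
have aff i (c d : R) : smooth (fun x => c * x ord0 i + d).
  apply: smoothD; last exact: (smooth_cst d).
  by apply: smoothM; [exact: (smooth_cst c)|exact: smooth_coord].
apply: (@smooth_prod _ _ _ _ (fun i x => flat 0 (k * (x ord0 i - a ord0 i)) *
   flat 0 (k * (b ord0 i - x ord0 i)))) => i.
apply: smoothM; apply: smooth_flat.
  under eq_fun do rewrite mulrBr; exact: aff.
under eq_fun do rewrite mulrBr addrC -mulNr; exact: aff.
Qed.

Lemma bump_ge0 k a b x : 0 <= bump k a b x.
Proof. by apply: prodr_ge0 => i _; rewrite mulr_ge0 ?flat_ge0. Qed.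

Lemma bump_le1 k a b x : bump k a b x <= 1.
Proof.
apply: prodr_ile1 => i _; rewrite mulr_ge0 ?flat_ge0//=.
by apply: mulr_ile1; rewrite ?flat_ge0 ?flat0_le1.
Qed.

Lemma bump_gt0 k a b x : 0 < k -> obox a b x -> 0 < bump k a b x.
Proof.
move=> k0 xab; apply: prodr_gt0 => i _; have /andP[ax xb] := xab i.
by rewrite mulr_gt0// flat0_gt0// mulr_gt0// subr_gt0.
Qed.

Lemma bump_eq0 k a b x : 0 <= k -> ~ obox a b x -> bump k a b x = 0.
Proof.
move=> k0 /existsNP[i /negP]; rewrite negb_and -!leNgt => xab.
apply/eqP; rewrite /bump prodf_seq_eq0; apply/hasP; exists i.
  exact: mem_index_enum.
rewrite /= mulf_eq0; case/orP: xab => xi; apply/orP; [left|right];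
  by rewrite flat_eq0// mulr_ge0_le0// subr_le0.
Qed.

Lemma bump_cvg a b x :
  (fun k => bump k.+1%:R a b x) @ \oo --> (\1_(obox a b) x : R).
Proof.
rewrite indicE; have [xab|xab] := boolP (x \in obox a b); last first.
  rewrite notin_setE in xab.
  by under eq_fun do rewrite bump_eq0//; exact: cvg_cst.
move/set_mem in xab; rewrite /bump.
elim: (index_enum _) => [|i r IH].
  by under eq_fun do rewrite big_nil; exact: cvg_cst.
under eq_fun do rewrite big_cons.
have /andP[ax xb] := xab i.
have h1 : (fun k => flat 0 (k.+1%:R * (x ord0 i - a ord0 i))) @ \oo --> (1 : R).
  by apply: flat0_cvg1; rewrite subr_gt0.
have h2 : (fun k => flat 0 (k.+1%:R * (b ord0 i - x ord0 i))) @ \oo --> (1 : R).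
  by apply: flat0_cvg1; rewrite subr_gt0.
have h12 := cvgM (cvgM h1 h2) IH; rewrite !mul1r in h12; exact: h12.
Qed.

Lemma vanishes_off_bump k a b a' b' : 0 <= k ->
  obox a b `<=` cbox a' b' -> vanishes_off a' b' (bump k a b).
Proof. by move=> k0 sub x xab; apply: bump_eq0 => // /sub. Qed.

(** Dominated convergence along bumps of increasing steepness. *)
Lemma Rintegral_obox_eq0 a b c d (T : 'rV[R]_n -> R) :
  (leb n).-integrable (cbox a b) (EFin \o T) ->
  (forall f, smooth f -> vanishes_off a b f ->
     \int[leb n]_(x in cbox a b) (T x * f x) = 0) ->
  obox c d `<=` cbox a b ->
  (\int[leb n]_(x in obox c d) (T x)%:E = 0)%E.
Proof.
move=> iT T0 cdab.
have mab := @measurable_cbox _ _ a b; have mcd := @measurable_obox _ _ c d.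
have mT := measurable_int _ iT.
have bumpT k : vanishes_off a b (bump k.+1%:R c d) by exact: vanishes_off_bump.
pose F k x := (T x * bump k.+1%:R c d x)%:E.
have iF k : (leb n).-integrable (cbox a b) (F k).
  exact: integrable_mul_smooth (smooth_bump _ _ _) (bumpT k).
pose G x := (T x * \1_(obox c d) x)%:E.
have GE : G = (EFin \o T) \_ (obox c d).
  apply/funext => x; rewrite /G /patch indicE; case: ifPn => _; rewrite ?mulr1//.
  by rewrite mulr0.
have mG : measurable_fun (cbox a b) G.
  apply/measurable_EFinP/measurable_funM; first exact/measurable_EFinP.
  exact: measurable_indic.
have [||||] := @dominated_convergence _ _ R (leb n) (cbox a b) mab F
  G (fun x => `|(T x)%:E|)%E _ mG.
- by move=> k; exact: measurable_int (iF k).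
- apply: aeW => x xab; apply: cvg_EFin; first exact: nearW.
  apply: cvgM; [exact: cvg_cst|exact: bump_cvg].
- exact: integrable_abse.
- apply: aeW => x k xab; rewrite /F /= lee_fin normrM ler_piMr//.
  by rewrite ger0_norm ?bump_ge0// bump_le1.
- move=> _ _; rewrite GE -integral_mkcondr setIidr//.
  rewrite (_ : [sequence _]_k = cst 0%E); last first.
    apply/funext => k /=.
    have := T0 _ (smooth_bump k.+1%:R c d) (bumpT k).
    rewrite /Rintegral => /eqP; rewrite fine_eq0; first by move=> /eqP.
    exact: (integrable_fin_num mab (iF k)).
  by move=> /(cvg_unique _ (cvg_cst _)) <-.
Qed.

End bump.

(** * The fundamental lemma of the calculus of variations *)

Section fundamental_lemma.
Context {R : realType} {n : nat}.
Implicit Types (a b x : 'rV[R]_n).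

(** Extended bounds let one family contain both the half-spaces that generate
    the sigma-algebra and their finite intersections. *)
Definition orthant (e : 'I_n -> \bar R) : set 'rV[R]_n :=
  [set x | forall i, (e i < (x ord0 i)%:E)%E].

Lemma measurable_orthant e : measurable (orthant e).
Proof.
apply: (@measurable_coord_forall R n (fun i => [set t | (e i < t%:E)%E])) => i.
case: (e i) => [r| |].
- rewrite (_ : mkset _ = [set` `]r, +oo[]); first exact: measurable_itv.
  by apply/seteqP; split=> t /=; rewrite lte_fin in_itv/= andbT.
- rewrite (_ : mkset _ = set0); first exact: measurable0.
  by apply/seteqP; split.
- rewrite (_ : mkset _ = setT); first exact: measurableT.
  by apply/seteqP; split=> t //= _; rewrite ltNyr.
Qed.

Lemma measurable_orthantE :
  (measurable : set (set 'rV[R]_n)) = <<s range orthant >>.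
Proof.
apply/seteqP; split; last first.
  apply: smallest_sub; first exact: sigma_algebra_measurable.
  by move=> _ [e _ <-]; exact: measurable_orthant.
apply: smallest_sub; first exact: smallest_sigma_algebra.
move=> A; rewrite -bigcup_seq => -[i /= _ [B mB <-]].
have : measurable_fun [set: g_sigma_algebraType (range orthant)]
    (fun x => x ord0 i : measurableTypeR R).
  apply: (measurability _ (RGenOInfty.measurableE R)) => _ [_ [t ->] <-].
  apply: sub_sigma_algebra.
  exists (fun j => if j == i then t%:E else -oo%E) => //.
  apply/seteqP; split=> x /=.
    by move=> /(_ i); rewrite eqxx lte_fin in_itv/= andbT.
  rewrite in_itv/= andbT => -[_ tx] j; case: eqVneq => [->|_].
    by rewrite lte_fin.
  by rewrite ltNyr.
by move=> /(_ measurableT B mB).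
Qed.

(** The integral of [T] vanishes on the trace of every orthant on the box, as
    such a trace is itself an open box; orthants form a pi-system generating the
    sigma-algebra, so it vanishes on every measurable subset. *)
Lemma fundamental_lemma_of_calculus_of_variations a b (T : 'rV[R]_n -> R) :
  (leb n).-integrable (cbox a b) (EFin \o T) ->
  (forall f, smooth f -> vanishes_off a b f ->
     \int[leb n]_(x in cbox a b) (T x * f x) = 0) ->
  ae_in (obox a b) (fun x => T x = 0).
Proof.
move=> iT T0.
have mo := @measurable_obox _ _ a b.
have iTo : (leb n).-integrable (obox a b) (EFin \o T).
  by apply: integrableS iT => //; [exact: measurable_cbox|exact: obox_cbox].
have T0ab c d : obox c d `<=` cbox a b ->
    (\int[leb n]_(x in obox c d) (T x)%:E = 0)%E.
  by move=> cd; exact: Rintegral_obox_eq0 T0 cd.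
have T0S S : measurable S -> (\int[leb n]_(x in obox a b `&` S) (T x)%:E = 0)%E.
  rewrite measurable_orthantE; move: S.
  apply: (@dynkin_induction _ 'rV[R]_n (range orthant)).
  - exact: measurable_orthantE.
  - move=> _ _ [e _ <-] [e' _ <-].
    exists (fun i => Order.max (e i) (e' i)) => //.
    apply/seteqP; split=> x /=.
      by move=> h; split=> i; have := h i; rewrite gt_max => /andP[].
    by move=> [h h'] i; rewrite gt_max h h'.
  - by rewrite setIT T0ab//; exact: obox_cbox.
  - move=> _ [e _ <-].
    (* The lower corner of the trace of the orthant on the box; a bound
       [+oo] yields an empty box. *)
    pose c : 'rV[R]_n := \row_i match e i with
      | r%:E => Num.max (a ord0 i) r | -oo => a ord0 i | +oo => b ord0 i end%E.
    have -> : obox a b `&` orthant e = obox c b.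
      apply/seteqP; split=> x /=.
        move=> [xab xe] i; have := xe i; have /andP[ax xb] := xab i.
        rewrite mxE; case: (e i) => [r| |] //=.
        by rewrite lte_fin gt_max ax xb => ->.
      move=> h; split=> i; have := h i; rewrite mxE;
        case: (e i) => [r| |]; rewrite ?gt_max ?lte_fin ?ltNyr//.
      - by move=> /andP[/andP[-> _] ->].
      - by move=> /andP[/lt_trans h1 /h1]; rewrite ltxx.
      - by move=> /andP[/andP[_ ->]].
      - by move=> /andP[/lt_trans h1 /h1]; rewrite ltxx.
    apply: T0ab => x xcb; apply: obox_cbox => i; have := xcb i.
    rewrite mxE; case: (e i) => [r| |]//.
      by rewrite gt_max => /andP[/andP[-> _] ->].
    by move=> /andP[/lt_trans h1 /h1]; rewrite ltxx.
  - move=> S mS S0; have := T0ab _ _ (@obox_cbox _ _ a b).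
    rewrite -{1}(setUIDK (obox a b) S) -setDE integral_setU//.
    + by rewrite S0 add0e.
    + exact: measurableI.
    + exact: measurableD.
    + by rewrite setUIDK; exact: measurable_int iTo.
    + by rewrite disj_set2E; apply/eqP/seteqP; split=> // x [[_ Sx] [_ /(_ Sx)]].
  - move=> F mF tF F0; rewrite setI_bigcupr integral_bigcup//.
    + by rewrite eseries0// => k _ _; exact: F0.
    + exact: trivIset_setIl.
    + by move=> k; exact: measurableI.
    + rewrite -setI_bigcupr; apply: integrableS iTo => //.
      by apply: measurableI => //; exact: bigcupT_measurable.
have : ae_eq (leb n) (obox a b) (EFin \o T) (cst 0%E).
  apply: integral_ae_eq => // E Eab mE.
  by rewrite integral0 -(setIidr Eab) T0S.
by apply: filterS => x + xab => /(_ xab) [].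
Qed.

End fundamental_lemma.

(** * Mollification *)

(** Heine's theorem, from the near-covering form of compactness: the property
    required of a radius [d] holds locally around each point for small [d]. *)
Lemma compact_uniformly_continuous (R : realType) n (A : set 'rV[R]_n)
    (f : 'rV[R]_n -> R) (e : R) : 0 < e -> compact A ->
  (forall x, A x -> {for x, continuous f}) ->
  exists2 d : R, 0 < d & forall x y, A x -> A y -> `|x - y| < d ->
    `|f x - f y| <= e.
Proof.
move=> e0 /compact_near_coveringP cA cf.
have e2 : 0 < e / 2 by rewrite divr_gt0.
pose P d x := forall y, A x -> A y -> `|x - y| < d -> `|f x - f y| <= e.
have /filter_ex : \forall d \near 0^'+, 0 < d /\ A `<=` P d.
  apply: filterI; first exact: nbhs_right_gt.
  apply: (cA R 0^'+ P) => x Ax.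
  have /cvgrPdist_lt/(_ _ e2)/nbhs_ballP[r /= r0 rf] := cf x Ax.
  have r2 : 0 < r / 2 by rewrite divr_gt0.
  have {}rf u : `|x - u| < r -> `|f x - f u| < e / 2.
    by move=> xu; apply: rf; rewrite -ball_normE.
  near=> x' d => y _ _ /= x'y.
  have xx' : `|x - x'| < r / 2.
    by near: x'; apply/nbhs_ballP; exists (r / 2) => // u; rewrite -ball_normE.
  have dr : d < r / 2 by near: d; exact: nbhs_right_lt.
  have fx' : `|f x - f x'| < e / 2 by apply: rf; lra.
  have fy : `|f x - f y| < e / 2.
    apply: rf; rewrite -(subrKA x'); apply: le_lt_trans (ler_normD _ _) _. lra.
  rewrite -(subrKA (f x)); apply: le_trans (ler_normD _ _) _.
  by rewrite (distrC (f x')); lra.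
by move=> [d [d0 AP]]; exists d => // x y Ax Ay; apply: AP.
Unshelve. all: by end_near. Qed.

Section mollify.
Context {R : realType} {n : nat}.
Variables (a b : 'rV[R]_n) (w rho : 'rV[R]_n -> R) (a' b' : 'rV[R]_n).
Hypothesis iw : (leb n).-integrable (cbox a b) (EFin \o w).
Hypothesis srho : smooth rho.
Hypothesis rho0 : vanishes_off a' b' rho.
Let Q := cbox a b.
Let mQ : measurable Q := @measurable_cbox R n a b.

(** The sign convention [rho (y - z)] makes [mollify z] the integral of [w]
    against a bump centred at [z], so that derivatives fall on a test function.
    *)
Definition mollify (z : 'rV[R]_n) : R :=
  \int[leb n]_(y in Q) (w y * rho (y - z)).

Lemma integrable_mul_bounded (h : 'rV[R]_n -> R) C : smooth h ->
  (forall y, `|h y| <= C) ->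
  (leb n).-integrable Q (EFin \o (fun y => w y * h y)).
Proof.
move=> sh hC; apply: (integrableMl (h := h) mQ iw).
  by apply: measurable_funTS; exact: measurable_smooth.
exists C; split; first exact: num_real.
by move=> M CM x _; apply: le_trans (hC x) (ltW CM).
Qed.

Lemma normr_Rintegral_mul_le (h : 'rV[R]_n -> R) B :
  (leb n).-integrable Q (EFin \o (fun y => w y * h y)) ->
  (forall y, Q y -> `|h y| <= B) ->
  `|\int[leb n]_(y in Q) (w y * h y)| <= B * \int[leb n]_(y in Q) `|w y|.
Proof.
move=> iwh hB; apply: le_trans (le_normr_Rintegral mQ iwh) _.
have iaw : (leb n).-integrable Q (EFin \o (fun y => `|w y|)).
  exact: (integrable_abse iw).
rewrite -RintegralZl//; apply: le_Rintegral => //.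
- exact: (integrable_abse iwh).
- exact: (integrableZl mQ B iaw).
- by move=> y Qy; rewrite normrM mulrC ler_wpM2r// hB.
Qed.

Lemma integrable_translate z (h : 'rV[R]_n -> R) :
  smooth h -> vanishes_off a' b' h ->
  (leb n).-integrable Q (EFin \o (fun y => w y * h (y - z))).
Proof.
move=> sh h0; have [C _ hC] := smooth_bounded sh h0.
apply: (@integrable_mul_bounded (fun y => h (y - z)) C) => [|y]; last exact: hC.
exact: smooth_translate.
Qed.

Lemma mollify_continuous : continuous mollify.
Proof.
move=> z; apply/(@cvgrPdist_le _ _ _ (nbhs z)) => e e0.
pose W := \int[leb n]_(y in Q) `|w y|.
have W0 : 0 <= W by exact: Rintegral_ge0.
have W1 : 0 < W + 1 by lra.
pose K := cbox (a - z - const_mx 1) (b - z + const_mx 1).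
have [|d d0 rhod] := compact_uniformly_continuous (divr_gt0 e0 W1)
  (@compact_cbox _ _ (a - z - const_mx 1) (b - z + const_mx 1)) (f := rho).
  by move=> x _; exact: smooth_continuous.
near=> z'.
have zz'd : `|z - z'| < d.
  by near: z'; apply/nbhs_ballP; exists d => // u; rewrite -ball_normE.
have zz'1 : `|z - z'| <= 1.
  near: z'; apply/nbhs_ballP; exists 1 => //= u.
  by rewrite -ball_normE /= => /ltW.
rewrite /mollify -RintegralB//; [|exact: integrable_translate..].
under eq_Rintegral do rewrite -mulrBr.
apply: (@le_trans _ _ (e / (W + 1) * W)).
  apply: normr_Rintegral_mul_le.
    apply: eq_integrable (integrableB mQ (integrable_translate z srho rho0)
      (integrable_translate z' srho rho0)) => // y _ /=.
    by rewrite mulrBr EFinB.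
  move=> y Qy; apply: rhod.
  - by move=> i; rewrite !mxE; have := Qy i; lra.
  - move=> i; rewrite !mxE; have := Qy i.
    have /(mx_norm_leP _ ler01)/(_ i) := zz'1.
    by rewrite !mxE ler_norml; lra.
  - rewrite (_ : y - z - (y - z') = z' - z) 1?distrC//.
    by rewrite opprB addrC subrKA.
by rewrite mulrAC ler_pdivrMr// ler_wpM2l//; lra.
Unshelve. all: by end_near. Qed.

Lemma partial3_bounded : exists C, forall i x,
  `|partial i (partial i (partial i rho)) x| <= C.
Proof.
have /choice[C C3] i : exists C, 0 <= C /\
    forall x, `|partial i (partial i (partial i rho)) x| <= C.
  have [||C] := @smooth_bounded _ _ a' b' (partial i (partial i (partial i rho))).
  - by do 3!apply: smooth_partial.
  - by do 3!apply: (@vanishes_off_partial _ _ _ _ i).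
  - by exists C.
exists (\sum_i C i) => i x; apply: le_trans (proj2 (C3 i) x) _.
by rewrite (bigD1 i)//= lerDl sumr_ge0// => j _; case: (C3 j).
Qed.

(** The cubic error bound replaces differentiation under the integral sign: at a
    maximum, dividing by [t^2] and letting [t] tend to [0] gives the sign of the
    integral of [w] against the second derivative. *)
Lemma mollify_second_difference : exists C, forall z i t, 0 <= t ->
  t ^+ 2 * \int[leb n]_(y in Q) (w y * partial i (partial i rho) (y - z)) -
    C * t ^+ 3 <=
  mollify (z + t *: delta_mx ord0 i) + mollify (z - t *: delta_mx ord0 i) -
    2 * mollify z.
Proof.
have [C3 C3rho] := partial3_bounded.
exists (2 * C3 * \int[leb n]_(y in Q) `|w y|) => z i t t0.
have srho2 : smooth (partial i (partial i rho)) by do 2!apply: smooth_partial.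
have rho20 := @vanishes_off_partial _ _ _ _ i _
  (@vanishes_off_partial _ _ _ _ i _ rho0).
set e := delta_mx ord0 i.
have iF z' := integrable_translate z' srho rho0.
have i2 := integrable_translate z srho2 rho20.
(* The Taylor error of the moving bump, uniformly of order [t^3]. *)
pose D y := rho (y - z + t *: e) + rho (y - z + (- t) *: e) -
  2 * rho (y - z) - t ^+ 2 * partial i (partial i rho) (y - z).
have wDE y : w y * D y = w y * rho (y - (z - t *: e)) +
    w y * rho (y - (z + t *: e)) - 2 * (w y * rho (y - z)) -
    t ^+ 2 * (w y * partial i (partial i rho) (y - z)).
  by rewrite /D scaleNr opprB opprD !addrA (addrAC y); ring.
pose r1 y := w y * rho (y - (z - t *: e)).
pose r2 y := w y * rho (y - (z + t *: e)).
pose r0 y := w y * rho (y - z).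
pose r3 y := w y * partial i (partial i rho) (y - z).
have i12 : (leb n).-integrable Q (EFin \o (fun y => r1 y + r2 y)).
  exact: (integrableD mQ (iF (z - t *: e)) (iF (z + t *: e))).
have i0 : (leb n).-integrable Q (EFin \o (fun y => 2 * r0 y)).
  exact: (integrableZl mQ 2 (iF z)).
have i120 : (leb n).-integrable Q (EFin \o (fun y => r1 y + r2 y - 2 * r0 y)).
  exact: (integrableB mQ i12 i0).
have i3 : (leb n).-integrable Q (EFin \o (fun y => t ^+ 2 * r3 y)).
  exact: (integrableZl mQ (t ^+ 2) i2).
have DE : \int[leb n]_(y in Q) (w y * D y) =
    mollify (z + t *: e) + mollify (z - t *: e) - 2 * mollify z -
    t ^+ 2 * \int[leb n]_(y in Q) (w y * partial i (partial i rho) (y - z)).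
  under eq_Rintegral do rewrite wDE.
  rewrite (RintegralB mQ i120 i3) (RintegralB mQ i12 i0).
  rewrite (@RintegralD _ _ _ _ Q r1 r2 mQ (iF (z - t *: e)) (iF (z + t *: e))).
  rewrite (@RintegralZl _ _ _ _ Q r0 2 mQ (iF z)).
  rewrite (@RintegralZl _ _ _ _ Q r3 (t ^+ 2) mQ i2).
  by rewrite (addrC (Rintegral _ _ r1)).
have : `|\int[leb n]_(y in Q) (w y * D y)| <=
    2 * C3 * t ^+ 3 * \int[leb n]_(y in Q) `|w y|.
  apply: normr_Rintegral_mul_le.
    apply: eq_integrable (integrableB mQ i120 i3) => // y _ /=.
    by rewrite wDE EFinB.
  move=> y Qy.
  pose g s := rho (y - z + s *: e).
  pose g1 s := partial i rho (y - z + s *: e).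
  pose g2 s := partial i (partial i rho) (y - z + s *: e).
  pose g3 s := partial i (partial i (partial i rho)) (y - z + s *: e).
  have d1 (r : R) : is_derive r (1 : R) g (g1 r) by exact: is_derive_line.
  have d2 (r : R) : is_derive r (1 : R) g1 (g2 r).
    exact: (is_derive_line _ _ _ (smooth_partial i srho)).
  have d3 (r : R) : is_derive r (1 : R) g2 (g3 r).
    exact: (is_derive_line _ _ _ srho2).
  have := second_difference_le d1 d2 d3 (fun r => C3rho i _) t0.
  by rewrite /g /g2 scale0r addr0.
rewrite DE ler_norml => /andP[+ _].
by rewrite lerBrDr addrC -mulrA (mulrC (t ^+ 3)) mulrA.
Qed.

End mollify.

(** * Integrals of bumps and the squared Euclidean norm *)

Section local_maximum.
Context {R : realType} {n : nat}.
Implicit Types (a b x y z : 'rV[R]_n) (w T rho : 'rV[R]_n -> R).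

Lemma integrable_smooth_cbox a b f a' b' : smooth f -> vanishes_off a' b' f ->
  (leb n).-integrable (cbox a b) (EFin \o f).
Proof.
move=> sf f0; have [C _ fC] := smooth_bounded sf f0.
apply: measurable_bounded_integrable; first exact: measurable_cbox.
- exact: leb_cbox_lty.
- by apply: measurable_funTS; exact: measurable_smooth.
- exists C; split; first exact: num_real.
  by move=> M CM x _; apply: le_trans (fC x) (ltW CM).
Qed.

Lemma Rintegral_cbox_gt0 a b f : (forall i, a ord0 i < b ord0 i) ->
  smooth f -> vanishes_off a b f -> (forall x, 0 <= f x) ->
  (forall x, obox a b x -> 0 < f x) -> 0 < \int[leb n]_(x in cbox a b) f x.
Proof.
move=> ab sf f0 fge0 fgt0.
rewrite lt_neqAle Rintegral_ge0 ?andbT; last by move=> x _; exact: fge0.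
apply/eqP => int0.
have mab := @measurable_cbox R n a b.
have if0 := integrable_smooth_cbox a b sf f0.
have : (\int[leb n]_(x in cbox a b) `|(EFin \o f) x| = 0)%E.
  rewrite (eq_integral (EFin \o f)); last first.
    by move=> x _; rewrite gee0_abs// lee_fin.
  apply/eqP; rewrite -fine_eq0; last exact: (integrable_fin_num mab if0).
  by apply/eqP; rewrite int0.
move=> /(ae_eq_integral_abs _ mab (measurable_int _ if0))[N [mN N0 abN]].
have : (leb n (obox a b) <= leb n N)%E.
  apply: le_measure; rewrite ?inE//; first exact: measurable_obox.
  move=> x xab; apply: abN => /= /(_ (obox_cbox xab))/eqP.
  by rewrite eqe gt_eqF// fgt0.
by rewrite N0 leNgt leb_obox_gt0.
Qed.

(** Both integrals extend to the whole space, where the measure is translation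
    invariant. This makes the mass of the moving bump constant. *)
Lemma Rintegral_translate a b a' b' f z : smooth f -> vanishes_off a' b' f ->
  (forall x, 0 <= f x) -> cbox (a' + z) (b' + z) `<=` cbox a b ->
  \int[leb n]_(y in cbox a b) f (y - z) = \int[leb n]_(y in cbox a' b') f y.
Proof.
move=> sf f0 fge0 sub.
have v : vanishes_off a b (fun y => f (y - z)).
  move=> y yab; apply: f0 => h; apply: yab; apply: sub => i.
  by have := h i; rewrite !mxE; lra.
rewrite -(Rintegral_vanishes_off (@subsetT _ _) v).
rewrite -(Rintegral_vanishes_off (@subsetT _ _) f0).
congr fine; rewrite -(@ge0_integral_translate R n (EFin \o f) (- z))//.
by apply/measurable_EFinP; exact: measurable_smooth.
Qed.

(** [mollify a b w rho z - c * w z] is the integral of [(w y - w z) * rho (y -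
    z)]. *)
Lemma mollify_approx a b w rho a' b' z c eta :
  (leb n).-integrable (cbox a b) (EFin \o w) ->
  smooth rho -> vanishes_off a' b' rho -> (forall x, 0 <= rho x) ->
  \int[leb n]_(y in cbox a b) rho (y - z) = c ->
  (forall y, cbox a b y -> rho (y - z) != 0 -> `|w y - w z| <= eta) ->
  `|mollify a b w rho z - c * w z| <= c * eta.
Proof.
move=> iw sr r0 rge0 <- wz.
have mab := @measurable_cbox R n a b.
pose r y := rho (y - z).
have sr' : smooth r by exact: smooth_translate.
have v : vanishes_off (a' + z) (b' + z) r.
  move=> y yab; apply: r0 => h; apply: yab => i.
  by have := h i; rewrite !mxE; lra.
have ir := integrable_smooth_cbox a b sr' v.
have iwr : (leb n).-integrable (cbox a b) (EFin \o (fun y => w y * r y)).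
  exact: (integrable_translate iw z sr r0).
have izr : (leb n).-integrable (cbox a b) (EFin \o (fun y => r y * w z)).
  exact: (integrableZr mab (w z) ir).
have idr : (leb n).-integrable (cbox a b) (EFin \o (fun y => w y * r y - r y * w z)).
  exact: (integrableB mab iwr izr).
rewrite -(RintegralZr (w z) mab ir) -(RintegralZr eta mab ir).
rewrite /mollify -(RintegralB mab iwr izr).
apply: le_trans (le_normr_Rintegral mab idr) _.
apply: (le_Rintegral mab).
- exact: (integrable_abse idr).
- exact: (integrableZr mab eta ir).
- move=> y yab; rewrite (mulrC (r y)) -mulrBl normrM mulrC.
  rewrite (ger0_norm (rge0 _)) -/(r y).
  have [->|ry] := eqVneq (r y) 0; first by rewrite !mul0r.
  by apply: ler_wpM2l; [exact: rge0|exact: wz].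
Qed.

Definition sqn x : R := \sum_i x ord0 i ^+ 2.

Lemma smooth_sqn : smooth sqn.
Proof.
rewrite /sqn; elim: (index_enum _) => [|i r IH].
  by under eq_fun do rewrite big_nil; exact: smooth_cst.
under eq_fun do rewrite big_cons.
by apply: smoothD => //; apply: smoothM; exact: smooth_coord.
Qed.

Lemma sqnD x y : sqn (x + y) = sqn x + 2 * (\sum_i x ord0 i * y ord0 i) + sqn y.
Proof.
rewrite /sqn mulr_sumr -!big_split/=; apply: eq_bigr => i _; rewrite !mxE; ring.
Qed.

Lemma sqn_second_difference x e :
  sqn (x + e) + sqn (x - e) - 2 * sqn x = 2 * sqn e.
Proof.
rewrite !sqnD.
have -> : sqn (- e) = sqn e by apply: eq_bigr => i _; rewrite mxE sqrrN.
have -> : \sum_i x ord0 i * (- e) ord0 i = - \sum_i x ord0 i * e ord0 i.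
  by rewrite -sumrN; apply: eq_bigr => i _; rewrite mxE mulrN.
ring.
Qed.

Lemma sqn_delta (t : R) i : sqn (t *: delta_mx ord0 i) = t ^+ 2.
Proof.
rewrite /sqn (bigD1 i)//= big1 ?addr0 => [|j ji].
  by rewrite !mxE !eqxx mulr1.
by rewrite !mxE (negbTE ji) andbF mulr0 expr0n.
Qed.

Lemma sqr_le_sqn x i : x ord0 i ^+ 2 <= sqn x.
Proof. by rewrite /sqn (bigD1 i)//= lerDl sumr_ge0// => j _; exact: sqr_ge0. Qed.

End local_maximum.

(** * Subharmonic functions have no interior peak *)

Lemma Rintegral_ae_ge0 (R : realType) n (D : set 'rV[R]_n) f :
  measurable D -> (leb n).-integrable D (EFin \o f) ->
  ae_in D (fun x => 0 <= f x) -> 0 <= \int[leb n]_(x in D) f x.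
Proof.
move=> mD iF f0; rewrite /Rintegral.
rewrite (@ae_eq_integral _ _ _ (leb n) D (fun x => `|(f x)%:E|)%E)//.
- by apply/fine_ge0/integral_ge0.
- exact: measurable_int iF.
- exact: (measurable_int (leb n) (integrable_abse iF)).
- move: f0; rewrite /ae_in; apply: filterS => x f0 Dx.
  by rewrite /= ger0_norm// f0.
Qed.

Lemma le0_linear_bound (R : realType) (A C t0 : R) : 0 < t0 ->
  (forall t, 0 < t -> t <= t0 -> A <= C * t) -> A <= 0.
Proof.
move=> t00 AC; rewrite leNgt; apply/negP => A0.
have C1 : 0 < `|C| + 1 by rewrite ltr_wpDl.
pose t := Num.min t0 (A / (2 * (`|C| + 1))).
have t1 : 0 < t by rewrite lt_min t00 divr_gt0// mulr_gt0.
have tt0 : t <= t0 by rewrite ge_min lexx.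
have : t <= A / (2 * (`|C| + 1)) by rewrite ge_min lexx orbT.
rewrite ler_pdivlMr ?mulr_gt0// => tA.
have CA := AC t t1 tt0.
have Ct : C * t <= `|C| * t by rewrite ler_wpM2r ?ler_norm// ltW.
nra.
Qed.

(** The arithmetic behind the interior location of the maximum. Here [f], [w]
    and [q] are the values of the mollification, of [w] and of the squared norm
    at [x1] (index 1) and at the candidate maximum (index 0), and [d] is their
    squared distance: the gain [eps * d / 2 >= eps * r^2 / 8] exceeds twice the
    mollification error [eps * r^2 / 32], all up to the mass [c] of the bump. *)
Lemma far_from_peak (R : realType) (c eps r f1 f0 w1 w0 q1 q0 d : R) :
  0 < c -> 0 < eps -> 0 < r -> r ^+ 2 / 4 <= d ->
  f1 + c * (eps * q1 - eps / 2 * 0) <= f0 + c * (eps * q0 - eps / 2 * d) ->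
  - (c * (eps * r ^+ 2 / 32)) <= f1 - c * w1 ->
  f0 - c * w0 <= c * (eps * r ^+ 2 / 32) ->
  w0 + eps * q0 <= w1 + eps * q1 -> False.
Proof.
move=> c0 eps0 r0 rd G10 F1 F0 pk.
have er : 0 < c * (eps * r ^+ 2) by rewrite !mulr_gt0// exprn_gt0.
have : c * (eps * (r ^+ 2 / 4)) <= c * (eps * d) by rewrite !ler_pM2l.
have : c * (w0 + eps * q0) <= c * (w1 + eps * q1) by rewrite ler_pM2l.
lra.
Qed.

Lemma second_difference_at_max (R : realType) (c fp fm f0 pp pm p0 : R) :
  fp + c * pp <= f0 + c * p0 -> fm + c * pm <= f0 + c * p0 ->
  fp + fm - 2 * f0 <= - (c * (pp + pm - 2 * p0)).
Proof. lra. Qed.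

Lemma cancel_square (R : realType) (I C c eps t : R) : 0 < t ->
  t ^+ 2 * I - C * t ^+ 3 <= - (c * (eps * t ^+ 2)) -> I + c * eps <= C * t.
Proof.
move=> t0 h; have tt : 0 < t ^+ 2 by rewrite exprn_gt0.
by rewrite -(ler_pM2l tt) -subr_le0; move: h; rewrite -subr_le0; congr (_ <= _); ring.
Qed.

(** If [w + eps * sqn] peaked at [x1], the function [G] below, a mollification
    of [w] plus a quadratic, would have an interior maximum in a smaller box,
    and the nonpositive second differences there contradict [Lap w >= 0]. *)
Lemma subharmonic_no_peak (R : realType) n (x1 : 'rV[R]_n) (r eps : R) w T :
  (0 < n)%N -> 0 < r -> 0 < eps ->
  let a := x1 - const_mx r in let b := x1 + const_mx r in
  (forall x, cbox a b x -> {for x, continuous w}) -> has_lap a b w T ->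
  ae_in (cbox a b) (fun x => 0 <= T x) ->
  (forall x, cbox a b x -> w x + eps * sqn x <= w x1 + eps * sqn x1) -> False.
Proof.
move=> n0 r0 eps0 a b cw wT T0 peak.
have [iw iT lapw] := wT.
pose Q' := cbox (x1 - const_mx (r / 2)) (x1 + const_mx (r / 2)).
have Q'E z i : Q' z -> x1 ord0 i - r / 2 <= z ord0 i <= x1 ord0 i + r / 2.
  by move=> /(_ i); rewrite !mxE.
have Q'Q : Q' `<=` cbox a b.
  by move=> z /Q'E zQ i; have := zQ i; rewrite !mxE; lra.
have Q'x1 : Q' x1 by move=> i; rewrite !mxE; lra.
(* [eta] is the admissible mollification error, see [far_from_peak]. *)
pose eta := eps * r ^+ 2 / 32.
have eta0 : 0 < eta by rewrite divr_gt0// mulr_gt0// exprn_gt0.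
have [d d0 wd] := compact_uniformly_continuous eta0 (@compact_cbox _ _ a b) cw.
(* The radius of the bump: below [d] for the modulus of continuity, and at
   most [r / 4] so that bumps centred in [Q'] stay inside the large box. *)
pose s := Num.min (d / 2) (r / 4).
have s0 : 0 < s by rewrite lt_min !divr_gt0.
have sd : s < d.
  by apply: (@le_lt_trans _ _ (d / 2)); [rewrite ge_min lexx|lra].
have sr : s <= r / 4 by rewrite ge_min lexx orbT.
pose lo : 'rV[R]_n := const_mx (- s); pose hi : 'rV[R]_n := const_mx s.
pose rho := bump 1 lo hi.
have srho : smooth rho by exact: smooth_bump.
have vrho : vanishes_off lo hi rho.
  by apply: vanishes_off_bump => //; exact: obox_cbox.
have rhoge0 x : 0 <= rho x by exact: bump_ge0.
pose c := \int[leb n]_(y in cbox lo hi) rho y.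
have c0 : 0 < c.
  apply: Rintegral_cbox_gt0 => //; first by move=> i; rewrite !mxE; lra.
  by move=> x xlh; exact: bump_gt0.
have rhoc z : Q' z -> \int[leb n]_(y in cbox a b) rho (y - z) = c.
  move=> /Q'E zQ; apply: Rintegral_translate => // y h i.
  by have := h i; have := zQ i; rewrite !mxE; lra.
pose F := mollify a b w rho.
have Fw z : Q' z -> `|F z - c * w z| <= c * eta.
  move=> zQ; apply: (mollify_approx iw srho vrho rhoge0 (rhoc z zQ)).
  move=> y yab rhoyz; apply: wd => //; first exact: Q'Q.
  apply: le_lt_trans sd; apply/(mx_norm_leP _ (ltW s0)) => i.
  have : cbox lo hi (y - z).
    by apply: contrapT => /vrho h; rewrite h eqxx in rhoyz.
  by move=> /(_ i); rewrite !mxE ler_norml.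
(* Along the axes [P] has second differences [eps * t^2]; subtracting half
   of the squared distance to [x1] makes the peak of [w + P] at [x1] strict. *)
pose P z := eps * sqn z - eps / 2 * sqn (z - x1).
pose G z := F z + c * P z.
have sP : smooth P.
  rewrite /P; under eq_fun do rewrite -mulNr.
  apply: smoothD; apply: smoothM; try exact: smooth_cst.
    exact: smooth_sqn.
  by apply: smooth_translate; exact: smooth_sqn.
have cG : {within Q', continuous G}.
  have cF : continuous F := mollify_continuous iw srho vrho.
  have scP : smooth (fun x => c * P x) := smoothM (smooth_cst c) sP.
  apply: continuous_subspaceT => z.
  exact: (continuousD (cF z) (@smooth_continuous _ _ _ scP z)).
have [z0 /set_mem Qz0 maxG] := EVT_max_rV (ex_intro _ x1 Q'x1)
  (@compact_cbox _ _ _ _) cG.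
have z0int i : `|z0 ord0 i - x1 ord0 i| < r / 2.
  rewrite ltNge; apply/negP => far.
  have sqfar : r ^+ 2 / 4 <= sqn (z0 - x1).
    apply: le_trans (sqr_le_sqn _ i); rewrite !mxE -[leRHS]real_normK ?num_real//.
    by rewrite (_ : r ^+ 2 / 4 = (r / 2) ^+ 2) ?lerXn2r ?nnegrE//; [lra|field].
  have Gx1z0 : G x1 <= G z0 by apply: maxG; exact/mem_set.
  have := Fw _ Qz0; have := Fw _ Q'x1; rewrite !ler_norml.
  move=> /andP[Fx1 _] /andP[_ Fz0].
  have pk := peak _ (Q'Q _ Qz0).
  have sq0 : sqn (x1 - x1) = 0 :> R.
    by rewrite subrr /sqn big1// => j _; rewrite mxE expr0n.
  move: Gx1z0; rewrite /G /P sq0 => Gx1z0.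
  exact: (far_from_peak c0 eps0 r0 sqfar Gx1z0 Fx1 Fz0 pk).
have [C secF] := mollify_second_difference iw srho vrho.
pose I i := \int[leb n]_(y in cbox a b)
  (w y * partial i (partial i rho) (y - z0)).
have I_le i : I i + c * eps <= 0.
  have t00 : 0 < r / 2 - `|z0 ord0 i - x1 ord0 i| by rewrite subr_gt0.
  apply: (@le0_linear_bound _ _ C _ t00) => t t1 tt0.
  have Qt (u : R) : `|u| <= t -> Q' (z0 + u *: delta_mx ord0 i).
    move=> ut j; rewrite !mxE eqxx /=; have := Q'E _ j Qz0.
    have [->|ji] := eqVneq j i; last by rewrite mulr0 addr0.
    have := ler_norm (z0 ord0 i - x1 ord0 i).
    have := ler_norm (- (z0 ord0 i - x1 ord0 i)); rewrite normrN.
    by move: ut tt0; rewrite mulr1 ler_norml; lra.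
  have Gp : G (z0 + t *: delta_mx ord0 i) <= G z0.
    by apply/maxG/mem_set/Qt; rewrite ger0_norm// ltW.
  have Gm : G (z0 - t *: delta_mx ord0 i) <= G z0.
    by rewrite -scaleNr; apply/maxG/mem_set/Qt; rewrite normrN ger0_norm// ltW.
  have sq1 := sqn_second_difference z0 (t *: delta_mx ord0 i).
  have sq2 := sqn_second_difference (z0 - x1) (t *: delta_mx ord0 i).
  have PE : P (z0 + t *: delta_mx ord0 i) + P (z0 - t *: delta_mx ord0 i) -
      2 * P z0 = eps * t ^+ 2.
    rewrite sqn_delta in sq1 sq2.
    rewrite /P (addrAC z0 (t *: _)) (addrAC z0 (- (t *: _))).
    transitivity (eps * (2 * t ^+ 2) - eps / 2 * (2 * t ^+ 2)); last by field.
    by rewrite -{1}sq1 -sq2; ring.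
  have second : t ^+ 2 * I i - C * t ^+ 3 <= - (c * (eps * t ^+ 2)).
    apply: le_trans (secF z0 i t (ltW t1)) _.
    by rewrite -PE; exact: (second_difference_at_max Gp Gm).
  exact: (cancel_square t1 second).
pose phi y := rho (y - z0).
have sphi : smooth phi by exact: smooth_translate.
have vphi : vanishes_off a b phi.
  move=> y yab; apply: vrho => h; apply: yab => i.
  by have := h i; have := Q'E _ i Qz0; rewrite !mxE; lra.
have lapphi y : lap phi y = \sum_i partial i (partial i rho) (y - z0).
  by apply: eq_bigr => i _; rewrite /phi !partial_translate.
have iI i : (leb n).-integrable (cbox a b)
    (EFin \o (fun y => w y * partial i (partial i rho) (y - z0))).
  apply: (integrable_translate iw z0 (smooth_partial i (smooth_partial i srho))).
  exact: (@vanishes_off_partial _ _ _ _ i _ (@vanishes_off_partial _ _ _ _ i _ vrho)).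
(* Strict because there is at least one direction. *)
have neg : \int[leb n]_(y in cbox a b) (w y * lap phi y) < 0.
  under eq_Rintegral do rewrite lapphi mulr_sumr.
  have [_ ->] := Rintegral_sum (index_enum _) (@measurable_cbox R n a b) iI.
  apply: (@le_lt_trans _ _ (\sum_(i < n) - (c * eps))).
    by apply: ler_sum => i _; rewrite -[leRHS]add0r lerBrDr I_le.
  by rewrite sumr_const card_ord pmulrn_llt0// oppr_lt0 mulr_gt0.
have : 0 <= \int[leb n]_(y in cbox a b) (T y * phi y).
  have mab := @measurable_cbox R n a b.
  apply: Rintegral_ae_ge0 => //; first exact: (integrable_translate iT z0 srho vrho).
  move: T0; rewrite /ae_in; apply: filterS => y Ty yab.
  by rewrite mulr_ge0// ?Ty//; exact: rhoge0.
by rewrite -lapw// leNgt neg.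
Qed.

(** * The maximum principle and the comparison of solutions *)

Lemma within_closure_continuous (R : realType) n (Om : set 'rV[R]_n)
    (w : 'rV[R]_n -> R) x : open Om ->
  {within closure Om, continuous w} -> Om x -> {for x, continuous w}.
Proof.
move=> oOm cw Omx.
have := continuous_subspaceW (@subset_closure _ Om) cw.
by rewrite continuous_open_subspace// => /(_ x (mem_set Omx)).
Qed.

Definition locally_subharmonic_at (R : realType) n (Om : set 'rV[R]_n)
    (w : 'rV[R]_n -> R) x :=
  exists r T, [/\ 0 < r, cbox (x - const_mx r) (x + const_mx r) `<=` Om,
    has_lap (x - const_mx r) (x + const_mx r) w T &
    ae_in (cbox (x - const_mx r) (x + const_mx r)) (fun y => 0 <= T y)].

(** A positive value of [w] is larger than the variation of [eps * sqn] on the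
    bounded domain for small [eps]; hence [w + eps * sqn] is maximal at an
    interior point where [w > 0], which is a peak. *)
Lemma maximum_principle (R : realType) m (Om : set 'rV[R]_m.+1)
    (w : 'rV[R]_m.+1 -> R) :
  open Om -> bounded_set Om -> {within closure Om, continuous w} ->
  (forall x, bdry Om x -> w x <= 0) ->
  (forall x, Om x -> 0 < w x -> locally_subharmonic_at Om w x) ->
  forall x, Om x -> w x <= 0.
Proof.
move=> oOm [M0 [_ OmM]] cw wbd wsub x Omx; rewrite leNgt; apply/negP => wx.
pose M := `|M0| + 1.
have M_ge0 : 0 <= M by rewrite addr_ge0.
have {}OmM y : Om y -> `|y| <= M.
  by apply: OmM; rewrite /M; have := ler_norm M0; lra.
have clM : closure Om `<=` cbox (- const_mx M) (const_mx M).
  rewrite closureE; apply: bigcap_inf; split; first exact: closed_cbox.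
  move=> y /OmM /(mx_norm_leP _ M_ge0) yM i.
  by have := yM i; rewrite !mxE ler_norml.
have cptO : compact (closure Om).
  apply: subclosed_compact (@compact_cbox _ _ _ _) clM; exact: closed_closure.
pose B := \sum_(i < m.+1) M ^+ 2.
have B0 : 0 <= B by apply: sumr_ge0 => i _; exact: sqr_ge0.
have sqnB y : closure Om y -> sqn y <= B.
  move=> /clM yM; apply: ler_sum => i _; rewrite -[leLHS]real_normK ?num_real//.
  by rewrite lerXn2r ?nnegrE// ler_norml; have := yM i; rewrite !mxE.
(* Chosen so that [eps * B < w x], where [B] bounds [sqn]. *)
pose eps := w x / (2 * (B + 1)).
have B1 : 0 < 2 * (B + 1) by lra.
have eps0 : 0 < eps by rewrite divr_gt0.
have epsB : eps * B < w x.
  rewrite /eps mulrAC ltr_pdivrMr// ltr_pM2l//; lra.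
have cG : {within closure Om, continuous (fun y => w y + eps * sqn y)}.
  have se : smooth (fun y : 'rV[R]_m.+1 => eps * sqn y).
    exact: (smoothM (smooth_cst eps) smooth_sqn).
  have cse := continuous_subspaceT (A := closure Om) (smooth_continuous se).
  by move=> y; exact: (cvgD (cw y) (cse y)).
have clx : closure Om x by exact: subset_closure.
have [x1 /set_mem clx1 maxx1] := EVT_max_rV (ex_intro _ x clx) cptO cG.
have epsx1 : eps * sqn x1 <= eps * B by rewrite ler_pM2l// sqnB.
have epsx : 0 <= eps * sqn x.
  by rewrite mulr_ge0 ?(ltW eps0)// sumr_ge0// => i _; exact: sqr_ge0.
have wx1 : 0 < w x1 by have := maxx1 x (mem_set clx); lra.
have Omx1 : Om x1.
  apply: contrapT => nO; have := wbd x1 (conj clx1 nO); lra.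
have [r [T [r0 rOm wT T0]]] := wsub x1 Omx1 wx1.
apply: (subharmonic_no_peak (ltn0Sn m) r0 eps0 _ wT T0).
  by move=> y /rOm; exact: within_closure_continuous.
by move=> y /rOm Omy; apply/maxx1/mem_set/subset_closure.
Qed.

Section comparison.
Context {R : realType} {m : nat}.
Variables (Om : set 'rV[R]_m.+1) (f1 f2 psi1 psi2 g1 g2 : 'rV[R]_m.+1 -> R).
Hypothesis oOm : open Om.
Hypothesis bOm : bounded_set Om.

Lemma within_continuousB (u v : 'rV[R]_m.+1 -> R) (A : set 'rV[R]_m.+1) :
  {within A, continuous u} -> {within A, continuous v} ->
  {within A, continuous (fun x => u x - v x)}.
Proof. by move=> cu cv x; exact: (cvgB (cu x) (cv x)). Qed.

(** Where [u1 - u2 > v1 - v2], neither the first constraint of [u] nor the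
    second one of [v] is active, so two of the four Laplacians are known and the
    other two are bounded on the right side. *)
Lemma two_system_difference_le u1 u2 L1 L2 v1 v2 K1 K2 :
  two_system Om f1 f2 psi1 psi2 g1 g2 u1 u2 L1 L2 ->
  two_system Om f1 f2 psi1 psi2 g1 g2 v1 v2 K1 K2 ->
  forall x, Om x -> u1 x - u2 x <= v1 x - v2 x.
Proof.
move=> [[[cu1 _] [cu2 _]] [[lu1 lu2] [ou [eu1 [_ [au bu]]]]]].
move=> [[[cv1 _] [cv2 _]] [[lv1 lv2] [ov [_ [ev2 [av bv]]]]]].
move=> x Omx; rewrite -subr_le0; move: x Omx.
apply: maximum_principle => //.
- exact: (within_continuousB (within_continuousB cu1 cu2)
    (within_continuousB cv1 cv2)).
- by move=> x xb; have [-> ->] := bu x xb; have [-> ->] := bv x xb; lra.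
- move=> x Omx wx.
  have [ou1 ou2] := ou x Omx; have [ov1 ov2] := ov x Omx.
  have [|U1 nU1 aU1] := eu1 x Omx; first lra.
  have [|U2 nU2 aU2] := ev2 x Omx; first lra.
  have nOm : nbhs x Om by exact: open_nbhs_nbhs.
  have [r r0 rU] := nbhs_cbox (filterI nOm (filterI nU1 nU2)).
  have rOm : cbox (x - const_mx r) (x + const_mx r) `<=` Om by move=> y /rU[].
  exists r, (fun y => (L1 y - L2 y) - (K1 y - K2 y)); split => //.
    by apply: has_lapB; apply: has_lapB; exact: weak_laplacian_has_lap rOm.
  rewrite /ae_in in aU1 aU2 au av *.
  apply: filterS2 (filterI aU1 aU2) (filterI au av) => y [eL1 eK2] [uy vy] yr.
  have [Oy [/eL1 -> /eK2 ->]] := rU y yr.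
  have [_ L2f] := uy Oy; have [K1f _] := vy Oy; lra.
Qed.

(** The equality of differences gives [u1 - v1] a second Laplacian [L2 - K2];
    the third equation makes one of the two nonnegative at almost every point.
    *)
Lemma three_system_le u1 u2 L1 L2 v1 v2 K1 K2 :
  two_system Om f1 f2 psi1 psi2 g1 g2 u1 u2 L1 L2 ->
  ae_in Om (fun x => Num.min (- L1 x + f1 x) (- L2 x + f2 x) = 0) ->
  two_system Om f1 f2 psi1 psi2 g1 g2 v1 v2 K1 K2 ->
  (forall x, Om x -> u1 x - u2 x = v1 x - v2 x) ->
  forall x, Om x -> u1 x <= v1 x.
Proof.
move=> [[[cu1 _] [cu2 _]] [[lu1 lu2] [ou [_ [_ [au bu]]]]]] mu.
move=> [[[cv1 _] [cv2 _]] [[lv1 lv2] [ov [_ [_ [av bv]]]]]] uv.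
move=> x Omx; rewrite -subr_le0; move: x Omx.
apply: maximum_principle => //.
- exact: within_continuousB.
- by move=> x xb; have [-> _] := bu x xb; have [-> _] := bv x xb; lra.
- move=> x Omx _.
  have nOm : nbhs x Om by exact: open_nbhs_nbhs.
  have [r r0 rOm] := nbhs_cbox nOm.
  pose a := x - const_mx r; pose b := x + const_mx r.
  have [i1 iT1 lap1] : has_lap a b (fun y => u1 y - v1 y) (fun y => L1 y - K1 y).
    by apply: has_lapB; exact: weak_laplacian_has_lap rOm.
  have [i2 iT2 lap2] : has_lap a b (fun y => u2 y - v2 y) (fun y => L2 y - K2 y).
    by apply: has_lapB; exact: weak_laplacian_has_lap rOm.
  have mab := @measurable_cbox R _ a b.
  (* Both are Laplacians of the same function. *)
  have eqT : ae_in (obox a b) (fun y => (L1 y - K1 y) - (L2 y - K2 y) = 0).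
    apply: fundamental_lemma_of_calculus_of_variations.
      exact: (integrableB mab iT1 iT2).
    move=> f sf f0; under eq_Rintegral do rewrite mulrBl.
    rewrite (RintegralB mab (integrable_mul_smooth mab iT1 sf f0)
      (integrable_mul_smooth mab iT2 sf f0)) -lap1// -lap2//.
    apply/eqP; rewrite subr_eq0; apply/eqP.
    apply: eq_Rintegral => y /set_mem/rOm/uv uvy; congr (_ * _); lra.
  exists (r / 2), (fun y => L1 y - K1 y).
  have subr : cbox (x - const_mx (r / 2)) (x + const_mx (r / 2)) `<=` obox a b.
    by move=> y yr i; have := yr i; rewrite !mxE; lra.
  have subOm : cbox (x - const_mx (r / 2)) (x + const_mx (r / 2)) `<=` Om.
    by move=> y /subr/obox_cbox/rOm.
  split=> //; first lra.
    by apply: has_lapB; exact: weak_laplacian_has_lap subOm.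
  rewrite /ae_in in eqT mu au av *.
  apply: filterS2 (filterI eqT mu) av => y [eT mOy] vy yr.
  have Oy := subOm y yr; have {}eT := eT (subr y yr).
  have [K1f K2f] := vy Oy.
  have := mOy Oy; rewrite minEle; case: ifPn => _ h; lra.
Qed.

End comparison.

Theorem corollary1 (R : realType) (m : nat) (Om : set 'rV[R]_m.+1) (alpha : R)
    (f1 f2 psi1 psi2 g1 g2 u1 u2 : 'rV[R]_m.+1 -> R)
    (domOm : bounded_domain Om) (smoothOm : smooth_boundary Om)
    (alpha01 : 0 < alpha < 1)
    (f1_holder : holder 0 alpha Om f1) (f2_holder : holder 0 alpha Om f2)
    (psi1_holder : holder 2 alpha Om psi1)
    (psi2_holder : holder 2 alpha Om psi2)
    (psi_ge0 : forall x, Om x -> 0 <= psi1 x + psi2 x)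
    (g1_C2 : Ck_bdry 2 Om g1) (g2_C2 : Ck_bdry 2 Om g2)
    (g12 : forall x, bdry Om x -> 0 <= g1 x - g2 x + psi1 x)
    (g21 : forall x, bdry Om x -> 0 <= g2 x - g1 x + psi2 x)
    (u_sol : solves_three_system Om f1 f2 psi1 psi2 g1 g2 u1 u2) :
  minimal_solution_two_system Om f1 f2 psi1 psi2 g1 g2 u1 u2.
Proof.
have [oOm _ _ bOm] := domOm.
have [L1 [L2 [u_two u_min]]] := u_sol.
split; first by exists L1, L2.
move=> v1 v2 [K1 [K2 v_two]] x Omx.
have uv y : Om y -> u1 y - u2 y = v1 y - v2 y.
  move=> Oy; apply/eqP; rewrite eq_le.
  rewrite (two_system_difference_le oOm bOm u_two v_two Oy).
  by rewrite (two_system_difference_le oOm bOm v_two u_two Oy).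
have u1v1 := three_system_le oOm bOm u_two u_min v_two uv Omx.
by split=> //; have := uv x Omx; lra.
Qed.
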